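(* For $k\ge-1$, the map $d$ is exact on $\bigoplus_j H^0(W_L,\mathcal{O}(1,\dots,1)(k\alpha)\otimes\wedge^j\Omega_L)^*$ except in bidegree $(0,0)$.
   Context: Let $L$ be a complex vector space of dimension $r$, and let $\ell_1,\dots,\ell_n \in L^*$ be linear forms (possibly zero, possibly proportional) with zero loci $H_1,\dots,H_n$ satisfying $H_1\cap\dots\cap H_n=0$. Set $E=\{1,\dots,n\}$. A flat is a subset $F\subseteq E$ such that if $\bigcap_{i\in F}H_i\subseteq H_j$ then $j\in F$; put $L_F=\bigcap_{i\in F}H_i$. A flat is proper if $F\ne E$. The augmented wonderful variety $W_L$ is the smooth projective variety obtained from $\mathbb{P}(L\oplus\mathbb{C})$ by blowing up the strict transforms of the strata $\mathbb{P}(L_F)$ of the hyperplane at infinity $\mathbb{P}L$, for $F$ a proper flat, in increasing order of dimension. It contains $L$ as an open subset, and $W_L\setminus L$ is a simple normal crossings divisor with irreducible components $D_F$, $F$ a proper flat, where $D_F$ is the strict transform of the exceptional divisor over $\mathbb{P}(L_F)$ (the strict transform of $\mathbb{P}L$ if $L_F=L$). $\Omega_L$ denotes the log cotangent bundle $\Omega^1_{W_L}(\log(W_L\setminus L))$. $\alpha$ is the pullback to $W_L$ of the hyperplane class of $\mathbb{P}(L\oplus\mathbb{C})$, and $\mathcal{O}(1,\dots,1)$ is the pullback of $\mathcal{O}(1)^{\boxtimes n}$ under the map $W_L\to(\mathbb{P}^1)^n$ extending $(\ell_1,\dots,\ell_n):L\to\mathbb{C}^n$. One identifies $\mathcal{O}(1,\dots,1)(k\alpha)=\mathcal{O}(\sum_F(n-|F|+k)D_F)$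 (sum over proper flats). Restriction to $L$ identifies $S:=\bigoplus_jH^0(W_L,\mathcal{O}(1,\dots,1)(k\alpha)\otimes\wedge^j\Omega_L)$ with a bigraded subspace of $\Psi_{L^*}=\operatorname{Sym}L^*\otimes\wedge^\bullet L^*$, the polynomial differential forms on $L$. Superspace: $\Psi_L=\operatorname{Sym}L\otimes\wedge^\bullet L$, bigraded by (commutative degree, anticommutative degree), with derivation $d$ (exterior derivative) of bidegree $(-1,1)$ with $d(v\otimes1)=1\otimes v$, $d(1\otimes v)=0$ for $v\in L$. $\Psi_L$ acts on $\Psi_{L^*}$ (action $\odot$): $v\otimes 1$ acts by the directional derivative $D_v$ on coefficients, $1\otimes v$ acts by contraction $\iota_v$. The inverse system of a bigraded ideal $I\subseteq\Psi_L$ is $I^\perp=\{g\in\Psi_{L^*}: f\odot g=0\text{ for all }f\in I\}$, and the pairing $(f,g)\mapsto$ (constant term of $f\odot g$) identifies $I^\perp$ with $(\Psi_L/I)^*$ as bigraded vector spaces. It is known that $S=I^\perp$ for a unique bigraded ideal $I\subseteq\Psi_L$ and that $I$ is closed under $d$. Thus $S^*$ is identified with $\Psi_L/I$, and $d$ on $S^*$ is the map of bidegree $(-1,1)$, with $d^2=0$, induced by $d:\Psi_L\to\Psi_L$. Exactness in bidegree $(a,b)$ means that the kernel of $d$ in bidegree $(a,b)$ equals the image of $d$ from bidegree $(a+1,b-1)$. *)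

(* Defs.v *)
From HB Require Import structures.
From mathcomp Require Import all_boot all_order all_algebra.
From mathcomp Require Import boolp classical_sets reals complex fraction mpoly.

Set Implicit Arguments.
Unset Strict Implicit.
Unset Printing Implicit Defensive.

Import GRing.Theory.
Local Open Scope ring_scope.
Local Open Scope classical_set_scope.

(* Throughout, L is C^r (row vectors), with standard basis e_0, ..., e_(r-1)
   and dual coordinates x_0, ..., x_(r-1); linear forms on L are column
   vectors. *)

(******************************************************************************)
(* Exterior algebras                                                          *)
(******************************************************************************)

(* A (x) /\(C^r): the value at J is the coefficient of the wedge product of
   the basis vectors indexed by J, taken in increasing order. *)
Notation "{ 'ext' A , r }" := {ffun {set 'I_r} -> A}
  (at level 0, A at level 90, r at level 90, format "{ 'ext'  A ,  r }").

Section Exterior.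
Variables (r : nat) (A : comNzRingType).
Implicit Types (I J M : {set 'I_r}) (u v : {ext A, r}).

(* e_I /\ e_J = shuffle_sign I J * e_(I :|: J) for disjoint I and J *)
Definition shuffle_sign I J : A :=
  (-1) ^+ #|[set p : 'I_r * 'I_r | [&& p.1 \in I, p.2 \in J & (p.2 < p.1)%N]]|.

Definition ext1 : {ext A, r} := [ffun J => (J == finset.set0)%:R].

Definition ext_gen (i : 'I_r) : {ext A, r} := [ffun J => (J == [set i]%SET)%:R].

Definition wedge u v : {ext A, r} :=
  [ffun M : {set 'I_r} => \sum_(I : {set 'I_r} | I \subset M)
     shuffle_sign I (M :\: I) * u I * v (M :\: I)].

Definition ext_map (h : A -> A) u : {ext A, r} := [ffun J => h (u J)].

Definition ext_scale (a : A) u : {ext A, r} := ext_map ( *%R a) u.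

(* contraction by the i-th vector of the dual basis *)
Definition contract (i : 'I_r) u : {ext A, r} :=
  [ffun J : {set 'I_r} =>
     if i \in J then 0 else shuffle_sign [set i]%SET J * u (i |: J)%SET].

Definition ext_component (b : nat) u : {ext A, r} :=
  [ffun J : {set 'I_r} => if #|J| == b then u J else 0].

End Exterior.

(******************************************************************************)
(* Superspace                                                                 *)
(******************************************************************************)

(* Both Psi_L and Psi_(L* ) are represented by superspace C r: in the first
   case the generators are the e_i, in the second one they are the x_i. *)
Notation superspace C r := {ext {mpoly C[r]}, r}.

Section Superspace.
Variables (C : fieldType) (r : nat).
Implicit Types (f g : superspace C r) (I : set (superspace C r)).

Definition superd f : superspace C r :=
  \sum_(i < r) wedge (ext_gen _ i) (ext_map (mderiv i) f).

(* The action of f in Psi_L on g in Psi_(L* ). *)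
Definition odot f g : superspace C r :=
  \sum_(J : {set 'I_r}) \sum_(m <- msupp (f J))
     ext_map (fun p => (f J)@_m *: mderivm m p)
             (foldr (@contract r {mpoly C[r]}) g (enum J)).

(* Bidegrees are integers, so that (a + 1, b - 1) always makes sense; in
   a bidegree with a negative entry only 0 is homogeneous. *)
Definition bihomog (a b : int) f : Prop :=
  forall (J : {set 'I_r}) (m : 'X_{1..r}), m \in msupp (f J) ->
    (mdeg m)%:Z = a /\ #|J|%:Z = b.

Definition bicomponent (a b : nat) f : superspace C r :=
  ext_component b (ext_map (pihomog mdeg a) f).

Definition bigraded_ideal I : Prop :=
  [/\ I 0,
      forall f g, I f -> I g -> I (f + g),
      forall f g, I g -> I (wedge f g) /\ I (wedge g f) &
      forall a b f, I f -> I (bicomponent a b f)].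

Definition inverse_system I : set (superspace C r) :=
  [set g | forall f, I f -> odot f g = 0].

(* Exactness in bidegree (a, b) of the map induced by superd on Psi_L / I,
   spelled out on representatives. *)
Definition exact_mod I (a b : int) : Prop :=
  forall f, bihomog a b f ->
    (I (superd f) <-> exists2 g, bihomog (a + 1) (b - 1) g & I (f - superd g)).

End Superspace.

(******************************************************************************)
(* Varieties as sets of local rings                                           *)
(******************************************************************************)

(* An integral separated scheme of finite type with function field K is
   determined by the set of the local rings of its (scheme-theoretic) points,
   viewed as subrings of K. The closure of a point xi is the set of points
   whose local ring is contained in that of xi. *)
Section Models.
Variable (K : fieldType).
Implicit Types (A P O xi G : set K) (X : set (set K)).

Definition is_subring : set (set K) :=
  [set A | [/\ A 1, forall x y, A x -> A y -> A (x - y) &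
               forall x y, A x -> A y -> A (x * y)]].

Definition is_ideal A : set (set K) :=
  [set P | [/\ P `<=` A, P 0, forall x y, P x -> P y -> P (x + y) &
               forall a x, A a -> P x -> P (a * x)]].

Definition prime_ideal A P : Prop :=
  [/\ is_ideal A P, ~ P 1 &
      forall x y, A x -> A y -> P (x * y) -> P x \/ P y].

Definition localize A P : set K :=
  [set x | exists a s, [/\ A a, A s, ~ P s & x = a / s]].

Definition maxideal O : set K := [set x | O x /\ (x = 0 \/ ~ O x^-1)].

Definition dominates O' O : Prop := O `<=` O' /\ maxideal O `<=` maxideal O'.

(* the stalk at O of the ideal sheaf of the closure of xi *)
Definition closure_ideal xi O : set K :=
  [set h | O h /\ (O `<=` xi -> maxideal xi h)].

(* The blow-up of X along the closure of xi is covered by the spectra of the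
   rings O[I / f], where I is the stalk of the ideal sheaf of the center at O
   and f is a nonzero element of I. *)
Definition blowup_chart xi O (f : K) : set K :=
  smallest is_subring (O `|` [set h / f | h in closure_ideal xi O]).

Definition blowup X xi : set (set K) :=
  [set O' | exists O f P,
     [/\ X O, closure_ideal xi O f, f != 0,
         prime_ideal (blowup_chart xi O f) P &
         O' = localize (blowup_chart xi O f) P]].

(* the points of the blow-up which lie over the closure of xi *)
Definition exceptional X xi : set (set K) :=
  [set O' | blowup X xi O' /\ exists O, [/\ X O, O `<=` xi & dominates O' O]].

Definition generic_point (Z : set (set K)) O : Prop :=
  Z O /\ forall O', Z O' -> O' `<=` O.

End Models.

(******************************************************************************)
(* Rational differential forms on L                                           *)
(******************************************************************************)

Notation ratfun C r := {fraction {mpoly C[r]}}.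
Notation ratform C r := {ext ratfun C r, r}.

Section RationalForms.
Variables (C : fieldType) (r : nat).

Definition ratfun_deriv (i : 'I_r) (x : ratfun C r) : ratfun C r :=
  let p := \n_(repr x) in let q := \d_(repr x) in
  tofrac (mderiv i p * q - p * mderiv i q) / tofrac (q ^+ 2).

Definition ratfun_d (x : ratfun C r) : ratform C r :=
  \sum_(i < r) ext_scale (ratfun_deriv i x) (ext_gen _ i).

Definition restricts_to (w : ratform C r) (f : superspace C r) : Prop :=
  forall J : {set 'I_r}, w J = tofrac (f J).

Definition is_submodule (O : set (ratfun C r)) : set (set (ratform C r)) :=
  [set M | [/\ M 0, forall u v, M u -> M v -> M (u + v) &
               forall a u, O a -> M u -> M (ext_scale a u)]].

End RationalForms.

(******************************************************************************)
(* The augmented wonderful variety                                            *)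
(******************************************************************************)

Section Wonderful.
Variables (C : fieldType) (n r : nat) (ell : 'I_n -> 'cV[C]_r).
Implicit Types (F : {set 'I_n}).

Local Notation K := (ratfun C r).

Definition hyperplane (i : 'I_n) : 'M[C]_r := kermx (ell i).

Definition stratum F : 'M[C]_r := (\bigcap_(i in F) hyperplane i)%MS.

Definition essential : Prop := (\bigcap_(i < n) hyperplane i)%MS = 0 :> 'M[C]_r.

Definition flat F : bool :=
  [forall j, (stratum F <= hyperplane j)%MS ==> (j \in F)].

Definition proper_flat F : bool := flat F && (F != [set: 'I_n]%SET).

(* Homogeneous coordinates on P(L (+) C), divided by the coordinate on C, which
   is indexed by None. *)
Definition hcoord (c : option 'I_r) : K :=
  if c is Some i then tofrac 'X_i else 1.

Definition proj_chart (c : option 'I_r) : set K :=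
  smallest (@is_subring K)
    (range (fun a : C => tofrac a%:MP_[r]) `|`
     range (fun c' => hcoord c' / hcoord c)).

Definition projspace : set (set K) :=
  [set O | exists c P,
     prime_ideal (proj_chart c) P /\ O = localize (proj_chart c) P].

Definition linform (l : 'cV[C]_r) : {mpoly C[r]} := \sum_(i < r) l i ord0 *: 'X_i.

(* P(L_F) is cut out by the coordinate on C and the linear forms which vanish
   on L_F. The ideal below is all of proj_chart c if P(L_F) does not meet this
   chart. *)
Definition stratum_ideal F (c : option 'I_r) : set K :=
  smallest (is_ideal (proj_chart c))
    ((hcoord None / hcoord c) |`
     [set tofrac (linform l) / hcoord c |
        l in [set l : 'cV[C]_r | stratum F *m l = 0]]).

(* The local ring of the generic point of P(L_F), computed in any of the charts
   which meet P(L_F). Blowing up a smaller or a disjoint center does not change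
   it, so this is also the local ring of the generic point of the strict
   transforms of P(L_F). *)
Definition stratum_point F : set K :=
  [set x | exists2 c, prime_ideal (proj_chart c) (stratum_ideal F c) &
                      localize (proj_chart c) (stratum_ideal F c) x].

(* The centers in increasing order of dimension; strict transforms of strata of
   the same dimension are disjoint when they are blown up, so their order is
   immaterial. *)
Definition proper_flats : seq {set 'I_n} :=
  sort (fun F G => (\rank (stratum F) <= \rank (stratum G))%N)
       (enum proper_flat).

Definition blowup_along (s : seq {set 'I_n}) : set (set K) :=
  foldl (@blowup K) projspace [seq stratum_point F | F <- s].

Definition wonderful : set (set K) := blowup_along proper_flats.

(* d is the local ring of the generic point of D_F. *)
Definition divisor_point F (d : set K) : Prop :=
  generic_point
    (exceptional (blowup_along (take (index F proper_flats) proper_flats))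
                 (stratum_point F)) d.

(* the stalk at O of the ideal sheaf of D_F; it is O if D_F does not contain
   the point *)
Definition divisor_ideal F (O : set K) : set K :=
  [set h | O h /\ forall d, divisor_point F d -> closure_ideal d O h].

(* f is a local equation of D_F at O (a unit of O if the point is not on D_F) *)
Definition local_equation F (O : set K) (f : K) : Prop :=
  O f /\ divisor_ideal F O = [set a * f | a in O].

(* Stalks of sheaves on W_L are viewed as subsets of their stalk at the generic
   point. W_L is smooth, so the D_F have local equations everywhere, and these
   are unique up to units. *)
Definition divisor_sheaf (m : {set 'I_n} -> int) (O : set K) : set K :=
  [set g | forall f : {set 'I_n} -> K,
     (forall F, proper_flat F -> local_equation F O (f F)) ->
     O (g * \prod_(F : {set 'I_n} | proper_flat F) (f F ^ m F))].

Definition log_generators (O : set K) : set (ratform C r) :=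
  [set ratfun_d h | h in O] `|`
  [set w | exists F f, [/\ proper_flat F, local_equation F O f &
                           w = ext_scale f^-1 (ratfun_d f)]].

(* the stalk at O of the j-th exterior power of the log cotangent bundle *)
Definition log_forms (j : nat) (O : set K) : set (ratform C r) :=
  smallest (is_submodule O)
    [set w | exists v : 'I_j -> ratform C r,
       (forall i, log_generators O (v i)) /\
       w = \big[@wedge r K/ext1 r K]_(i < j) v i].

Definition twisted_log_forms (m : {set 'I_n} -> int) (j : nat) (O : set K) :
    set (ratform C r) :=
  smallest (is_submodule O)
    [set w | exists g v, [/\ divisor_sheaf m O g, log_forms j O v &
                             w = ext_scale g v]].

Definition global_sections (m : {set 'I_n} -> int) (j : nat) :
    set (ratform C r) :=
  [set w | forall O, wonderful O -> twisted_log_forms m j O w].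

(* The multiplicities of the divisor on W_L \ L representing
   O(1, ..., 1)(k alpha): the hyperplane at infinity pulls back to the sum of
   all D_F, and the point at infinity of the i-th projective line to the sum of
   the D_F with i \notin F. *)
Definition twist (k : int) F : int := n%:Z - #|F|%:Z + k.

(* The sum over j of the spaces of global sections of
   O(1, ..., 1)(k alpha) (x) /\^j Omega_L, restricted to L. *)
Definition section_space (k : int) : set (superspace C r) :=
  [set f | forall j : nat, exists2 w,
     global_sections (twist k) j w & restricts_to w (ext_component j f)].

End Wonderful.

(* Main.v *)
(* On twisted logarithmic forms both the exterior derivative (as
   d (f^-m) = - m f^-m df/f) and contraction with the Euler field of L (as the
   scaling action of C^* on L extends to W_L) are defined, so S is stable under
   both. Dually, I is stable under koszul and under superd, and by Cartan's
   formula superd koszul + koszul superd is multiplication by a + b in bidegree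
   (a, b). Bidegree (0, 0) is not exact since 1 is in S for k >= -1.

   The Euler field preserves every local ring of W_L by induction on the
   blow-ups. For the generic point of an exceptional divisor, with maximal ideal
   M, the elements all of whose iterated Euler derivatives lie in M form a prime
   which still lies over the center, so it is M itself. *)

From HB Require Import structures.
Require Import Defs.
From mathcomp Require Import all_boot all_order all_algebra.
From mathcomp Require Import boolp classical_sets reals complex fraction mpoly.
From mathcomp Require Import ring zify finset.
Import GRing.Theory.
Local Open Scope ring_scope.

Set Implicit Arguments.
Unset Strict Implicit.
Unset Printing Implicit Defensive.

Import Num.Theory.

(** * Exterior algebras *)

(** [I] is known only through its inverse system, so everything rests on recovering [I] as the
    annihilator of [inverse_system I]. Superspace is infinite-dimensional; since [I] is bigraded, an
    element outside [I] can be separated from it within finitely many degrees, and characteristic 0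
    lets the separating functional be written as the pairing with some [g]. The roles cross over in
    the dualization: [koszul] on [I] corresponds to [superd] on sections and vice versa, up to a
    sign that bigraded ideals absorb.

    On the geometric side the two operators ask for different things. For the exterior derivative it
    is enough that [dh] and [df/f] are closed and that a twist [g = p^-1 a] has derivative
    [p^-1 (da - a dp/p)]. Contraction with the Euler field [E] sends [df/f] to [E f / f], whose
    regularity amounts to [E] preserving the ideal of [D_F]. This is what forces the study of local
    rings: [E] has to be lifted through every blow-up, and the centers and the divisors have to be
    shown invariant. *)

Section ExteriorOperators.
Variables (r : nat) (A : comNzRingType).
Implicit Types (i j : 'I_r) (J M : {set 'I_r}) (u v w : {ext A, r}) (a b : A).

Local Notation theta i := (wedge (@ext_gen r A i)).
Local Notation iota := (@contract r A).

(** The sign of moving the i-th generator past the smaller elements of [J], written as a product so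
    that elements of [J] can be added or removed one at a time. *)
Definition esign i J : A := \prod_(j in J) (if (j < i)%N then -1 else 1).

Lemma shuffle_sign1 i J : shuffle_sign A [set i]%SET J = esign i J.
Proof.
rewrite /shuffle_sign /esign -big_mkcondr /= prodr_const; congr (_ ^+ _).
transitivity #|(fun x => (i, x)) @: [set x in J | (x < i)%N]%SET|.
  apply: eq_card => -[p q]; apply/asboolP/imsetP => /= [|[x]].
    by rewrite in_set1 => /and3P[/eqP -> qJ lt_qi]; exists q; rewrite // inE qJ.
  by rewrite inE => /andP[xJ lt_xi] [-> ->]; rewrite in_set1 eqxx xJ.
rewrite card_imset; last by move=> x y [].
by apply: eq_card => x; rewrite inE.
Qed.

Lemma esignU1 i j J : j \notin J ->
  esign i (j |: J) = (if (j < i)%N then -1 else 1) * esign i J.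
Proof. by move=> jJ; rewrite /esign big_setU1. Qed.

Lemma esignU1_id i J : esign i (i |: J) = esign i J.
Proof.
have [iJ|iJ] := boolP (i \in J); first by rewrite (setUidPr _) ?sub1set.
by rewrite esignU1 // ltnn mul1r.
Qed.

Lemma esignD1 i j J : j \in J ->
  esign i J = (if (j < i)%N then -1 else 1) * esign i (J :\ j).
Proof. by move=> jJ; rewrite -{1}(setD1K jJ) esignU1 // !inE eqxx. Qed.

Lemma esignD1_id i J : esign i (J :\ i) = esign i J.
Proof.
have [iJ|iJ] := boolP (i \in J); first by rewrite (esignD1 i iJ) ltnn mul1r.
by congr (esign i _); apply/setDidPl; rewrite disjoint_sym disjoints1.
Qed.

Lemma esign_sqr i J : esign i J * esign i J = 1.
Proof.
rewrite /esign -big_split /= big1 // => j _.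
by case: ifP => _; rewrite ?mulrNN mulr1.
Qed.

Lemma contractE i u J :
  iota i u J = if i \in J then 0 else esign i J * u (i |: J)%SET.
Proof. by rewrite ffunE shuffle_sign1. Qed.

Lemma wedge_genE i u M :
  theta i u M = if i \in M then esign i M * u (M :\ i) else 0.
Proof.
rewrite ffunE; case: ifPn => iM.
  rewrite (bigD1 [set i]%SET) ?sub1set //= big1 => [|J /andP[_ neq_Ji]].
    by rewrite ffunE eqxx mulr1 addr0 shuffle_sign1 esignD1_id.
  by rewrite ffunE (negbTE neq_Ji) mulr0 mul0r.
apply: big1 => J sJM; rewrite ffunE; case: eqP => [defJ|_].
  by rewrite defJ sub1set (negbTE iM) in sJM.
by rewrite mulr0 mul0r.
Qed.

Lemma ext_scaleE a u J : ext_scale a u J = a * u J.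
Proof. by rewrite !ffunE. Qed.

Lemma ext_mapE (h : A -> A) u J : ext_map h u J = h (u J).
Proof. by rewrite ffunE. Qed.

Lemma ext_scaleDr a u v : ext_scale a (u + v) = ext_scale a u + ext_scale a v.
Proof. by apply/ffunP => J; rewrite !(ext_scaleE, ffunE) mulrDr. Qed.

Lemma ext_scaleNr a u : ext_scale a (- u) = - ext_scale a u.
Proof. by apply/ffunP => J; rewrite !(ext_scaleE, ffunE) mulrN. Qed.

Lemma ext_scaleDl a b u : ext_scale (a + b) u = ext_scale a u + ext_scale b u.
Proof. by apply/ffunP => J; rewrite !(ext_scaleE, ffunE) mulrDl. Qed.

Lemma ext_scale0r a : ext_scale a 0 = 0 :> {ext A, r}.
Proof. by apply/ffunP => J; rewrite !(ext_scaleE, ffunE) mulr0. Qed.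

Lemma ext_scale0l u : ext_scale 0 u = 0.
Proof. by apply/ffunP => J; rewrite !(ext_scaleE, ffunE) mul0r. Qed.

Lemma ext_scale1 u : ext_scale 1 u = u.
Proof. by apply/ffunP => J; rewrite ext_scaleE mul1r. Qed.

Lemma ext_scaleA a b u : ext_scale a (ext_scale b u) = ext_scale (a * b) u.
Proof. by apply/ffunP => J; rewrite !ext_scaleE mulrA. Qed.

Lemma ext_scale_sumr (T : Type) (s : seq T) a (F : T -> {ext A, r}) :
  ext_scale a (\sum_(t <- s) F t) = \sum_(t <- s) ext_scale a (F t).
Proof.
apply: (big_morph (ext_scale a)); [exact: ext_scaleDr|exact: ext_scale0r].
Qed.

Lemma wedgeDl u v w : wedge (u + v) w = wedge u w + wedge v w.
Proof.
apply/ffunP => J; rewrite !ffunE -big_split /=; apply: eq_bigr => M _.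
by rewrite !ffunE mulrDr mulrDl.
Qed.

Lemma wedgeDr u v w : wedge u (v + w) = wedge u v + wedge u w.
Proof.
apply/ffunP => J; rewrite !ffunE -big_split /=; apply: eq_bigr => M _.
by rewrite !ffunE mulrDr.
Qed.

Lemma wedgeZl a u v : wedge (ext_scale a u) v = ext_scale a (wedge u v).
Proof.
apply/ffunP => J; rewrite ext_scaleE !ffunE mulr_sumr; apply: eq_bigr => M _.
by rewrite !ffunE; ring.
Qed.

Lemma wedgeZr a u v : wedge u (ext_scale a v) = ext_scale a (wedge u v).
Proof.
apply/ffunP => J; rewrite ext_scaleE !ffunE mulr_sumr; apply: eq_bigr => M _.
by rewrite !ffunE; ring.
Qed.

Lemma wedge0r u : wedge u 0 = 0.
Proof. by have := wedgeZr 0 u 0; rewrite !ext_scale0l. Qed.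

Lemma wedge0l u : wedge 0 u = 0.
Proof. by have := wedgeZl 0 0 u; rewrite !ext_scale0l. Qed.

Lemma wedge_suml (T : Type) (s : seq T) (F : T -> {ext A, r}) v :
  wedge (\sum_(t <- s) F t) v = \sum_(t <- s) wedge (F t) v.
Proof.
apply: (big_morph (fun u => wedge u v)); last exact: wedge0l.
by move=> x y; rewrite wedgeDl.
Qed.

Lemma wedge_sumr (T : Type) (s : seq T) (F : T -> {ext A, r}) u :
  wedge u (\sum_(t <- s) F t) = \sum_(t <- s) wedge u (F t).
Proof. by apply: (big_morph (wedge u)) => [x y|];
  rewrite ?wedgeDr ?wedge0r. Qed.

Lemma wedge1l u : wedge (ext1 r A) u = u.
Proof.
apply/ffunP => M; rewrite ffunE (bigD1 set0) ?sub0set //= big1.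
  rewrite /ext1 ffunE eqxx mulr1 addr0 setD0 /shuffle_sign.
  rewrite eq_card0 ?mul1r // => p; apply/asboolP => /=.
  by rewrite inE.
by move=> J /andP[_ nJ0]; rewrite /ext1 ffunE (negbTE nJ0) mulr0 mul0r.
Qed.

Lemma contractD i u v : iota i (u + v) = iota i u + iota i v.
Proof.
apply/ffunP => J; rewrite [RHS]ffunE !contractE ffunE.
by case: ifP; rewrite ?addr0 ?mulrDr.
Qed.

Lemma contractZ i a u : iota i (ext_scale a u) = ext_scale a (iota i u).
Proof.
apply/ffunP => J; rewrite ext_scaleE !contractE ext_scaleE.
by case: ifP; rewrite ?mulr0 // mulrCA.
Qed.

Lemma contract0 i : iota i 0 = 0.
Proof. by have := contractZ i 0 0; rewrite !ext_scale0l. Qed.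

Lemma contractN i u : iota i (- u) = - iota i u.
Proof.
by apply/eqP; rewrite -addr_eq0 -contractD addNr contract0.
Qed.

Lemma contract_sum (T : Type) (s : seq T) (F : T -> {ext A, r}) i :
  iota i (\sum_(t <- s) F t) = \sum_(t <- s) iota i (F t).
Proof. by apply: (big_morph (iota i)) => [x y|];
  rewrite ?contractD ?contract0. Qed.

Lemma contract_anti i j u : iota i (iota j u) = - iota j (iota i u).
Proof.
apply/ffunP => J; rewrite [RHS]ffunE !contractE !inE.
have [->|neq_ij] := eqVneq i j; first by rewrite ?eqxx /= !mulr0; case: ifP;
  rewrite oppr0.
have [iJ|iJ] /= := boolP (i \in J); first by rewrite ?orbT ?mulr0 if_same oppr0.
have [jJ|jJ] /= := boolP (j \in J); first by rewrite ?orbT ?mulr0 oppr0.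
rewrite ?orbF !esignU1 // setUCA.
have: (i < j)%N = ~~ (j < i)%N.
  by rewrite ltnNge leq_eqVlt val_eqE eq_sym (negbTE neq_ij).
by move=> ->; case: (j < i)%N => /=; ring.
Qed.

(** Proved separately, because [contract_anti] only gives twice the square, and 2 may be a zero
    divisor in [A]. *)
Lemma contract_sq i u : iota i (iota i u) = 0.
Proof.
apply/ffunP => J; rewrite [RHS]ffunE !contractE !inE eqxx /= mulr0.
by case: ifP.
Qed.

Lemma wedge_gen_anti i j u : theta i (theta j u) = - theta j (theta i u).
Proof.
apply/ffunP => J; rewrite [RHS]ffunE !wedge_genE !inE.
have [->|neq_ij] := eqVneq i j; first by rewrite ?eqxx /= !mulr0; case: ifP;
  rewrite oppr0.
rewrite /=.
have [iJ|iJ] /= := boolP (i \in J); last by rewrite mulr0 if_same oppr0.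
have [jJ|jJ] /= := boolP (j \in J); last by rewrite mulr0 oppr0.
rewrite setDDl setUC -setDDl.
rewrite (esignD1 i jJ) (esignD1 j iJ).
have: (i < j)%N = ~~ (j < i)%N.
  by rewrite ltnNge leq_eqVlt val_eqE eq_sym (negbTE neq_ij).
by move=> ->; case: (j < i)%N => /=; ring.
Qed.

(** The Clifford relation. The commutation rules of [koszul], [superd] and their rational
    counterparts with generators and contractions are all derived from it. *)
Lemma contract_wedge_gen i j u :
  iota j (theta i u) = (if i == j then u else 0) - theta i (iota j u).
Proof.
apply/ffunP => J; rewrite [RHS]ffunE [X in _ = _ + X]ffunE wedge_genE !contractE
  wedge_genE !inE.
have [<-|neq_ij] := eqVneq i j.
  rewrite /= esignU1_id mulrA esign_sqr mul1r.
  have [iJ|iJ] := boolP (i \in J).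
    by rewrite esignD1_id mulrA esign_sqr mul1r setD1K // subrr.
  by rewrite subr0 setU1K.
rewrite /= ffunE.
have [iJ|iJ] /= := boolP (i \in J); last by rewrite mulr0 if_same subr0.
have [jJ|jJ] /= := boolP (j \in J); first by rewrite mulr0 subr0.
rewrite esignU1 // (esignD1 j iJ) (_ : (j |: J) :\ i = j |: (J :\ i))%SET;
  last first.
  apply/setP => x; rewrite !inE; case: (eqVneq x i) => [->|] //=.
  by rewrite (negbTE neq_ij).
have: (i < j)%N = ~~ (j < i)%N.
  by rewrite ltnNge leq_eqVlt val_eqE eq_sym (negbTE neq_ij).
by move=> ->; case: (j < i)%N => /=; ring.
Qed.

End ExteriorOperators.

(** * Superspace *)

Section IteratedContraction.
Variables (r : nat) (A : comNzRingType).
Implicit Types (i : 'I_r) (J : {set 'I_r}) (g : {ext A, r}).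

Local Notation iota := (@contract r A).

Lemma contract_foldr_cat i g s1 s2 :
  iota i (foldr iota g (s1 ++ s2)) =
  ext_scale ((-1) ^+ size s1) (foldr iota g (s1 ++ i :: s2)).
Proof.
elim: s1 => [|j s1 IHs1] /=; first by rewrite expr0 ext_scale1.
rewrite contract_anti IHs1 contractZ -ext_scaleNr exprS mulN1r.
by apply/ffunP => J; rewrite !(ext_scaleE, ffunE) mulrN mulNr.
Qed.

(** [enum J] is increasing, so [i] is inserted right after the elements of [J] smaller than [i], and
    these are the ones that [esign] counts. *)
Lemma enum_setU1_split i J : i \notin J ->
  exists s1 s2, [/\ enum J = s1 ++ s2, enum (i |: J) = s1 ++ i :: s2 &
                    (-1) ^+ size s1 = esign A i J].
Proof.
move=> iJ; have := mem_enum 'I_r i; rewrite inE.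
case/splitPr defI: _ / => [p1 p2].
have: uniq (enum 'I_r) by exact: enum_uniq.
have: pairwise (relpre val ltn) (enum 'I_r).
  rewrite -sorted_pairwise => [|x y z /=]; last exact: ltn_trans.
  by rewrite -sorted_map val_enum_ord iota_ltn_sorted.
rewrite defI pairwise_cat cat_uniq /= => /and3P[lt12 _ /andP[lt2 _]].
case/and3P=> _ /norP[ip1 _] /andP[ip2 _].
have drop_i p : i \notin p -> filter (mem (i |: J)) p = filter (mem J) p.
  move=> ip; apply: eq_in_filter => x px /=; rewrite !inE.
  by case: eqP => // defx; rewrite -defx px in ip.
have filterE (B : {set 'I_r}) : enum B = filter (mem B) (p1 ++ i :: p2).
  by rewrite -defI enumT.
exists (filter (mem J) p1), (filter (mem J) p2); split.
- by rewrite filterE filter_cat /= (negbTE iJ).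
- by rewrite filterE filter_cat /= !drop_i // !inE eqxx.
rewrite /esign -big_enum /= filterE filter_cat /= (negbTE iJ) big_cat /=.
rewrite (eq_big_seq (fun=> -1)) => [|j /[!mem_filter] /andP[_ p1j]]; last first.
  by have /andP[/= -> _] := allP lt12 _ p1j.
rewrite big_const_seq count_predT iter_mulr_1.
rewrite big1_seq ?mulr1 // => j /= /[!mem_filter] /andP[_ p2j].
have := allP lt2 _ p2j; rewrite /= ltnNge leq_eqVlt negb_or => /andP[_].
by move/negbTE => ->.
Qed.

Lemma contract_foldr_enum i g J :
  iota i (foldr iota g (enum J)) =
  if i \in J then 0 else
    ext_scale (esign A i J) (foldr iota g (enum (i |: J))).
Proof.
case: ifPn => [iJ|/enum_setU1_split[s1 [s2 [-> -> <-]]]]; last first.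
  exact: contract_foldr_cat.
have: i \notin J :\ i by rewrite !inE eqxx.
case/enum_setU1_split=> s1 [s2 []]; rewrite setD1K // => _ -> _.
(* For [i] in [J], the iterated contraction is, up to sign, itself a contraction by [i], so
   contracting once more gives 0. *)
have /(congr1 (ext_scale ((-1) ^+ size s1))) := contract_foldr_cat i g s1 s2.
by rewrite ext_scaleA -expr2 sqrr_sign ext_scale1 => <-;
  rewrite contractZ contract_sq ext_scale0r.
Qed.

End IteratedContraction.

(** * Polynomials as differential operators, and the action on superspace *)

Section PolynomialAction.
Variables (C : fieldType) (r : nat).
Implicit Types (i : 'I_r) (c : C) (p q : {mpoly C[r]}) (f g u : superspace C r).

Local Notation P := {mpoly C[r]}.

Definition pact p q : P := \sum_(m <- msupp p) p@_m *: mderivm m q.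

(** Summing over a fixed box of monomials instead of the support makes linearity in [p] a termwise
    matter. *)
Lemma pact_bound k p q : (msize p <= k)%N ->
  pact p q = \sum_(m : 'X_{1..r < k}) p@_m *: mderivm m q.
Proof.
move=> le_pk; pose I : subFinType _ := 'X_{1..r < k}.
rewrite /pact (ssrcomplements.big_mksub I) //=; first last.
  by move=> x /msize_mdeg_lt /leq_trans; apply.
  by rewrite msupp_uniq.
by rewrite big_rmcond //= => m; move/memN_msupp_eq0 ->; rewrite scale0r.
Qed.

Lemma pactDl p1 p2 q : pact (p1 + p2) q = pact p1 q + pact p2 q.
Proof.
pose k := (msize (p1 + p2) + msize p1 + msize p2)%N.
rewrite !(@pact_bound k) /k ?leq_addl //; first last.
- by rewrite -addnA leq_addr.
- by rewrite -addnA addnCA leq_addr.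
by rewrite -big_split /=; apply: eq_bigr => m _; rewrite mcoeffD scalerDl.
Qed.

Lemma pact0l q : pact 0 q = 0.
Proof. by rewrite /pact msupp0 big_nil. Qed.

Lemma pactZl c p q : pact (c *: p) q = c *: pact p q.
Proof.
pose k := (msize (c *: p) + msize p)%N.
rewrite !(@pact_bound k) /k ?leq_addl ?leq_addr // scaler_sumr.
by apply: eq_bigr => m _; rewrite mcoeffZ scalerA.
Qed.

Lemma pactX m q : pact 'X_[m] q = mderivm m q.
Proof. by rewrite /pact msuppX big_seq1 mcoeffX eqxx scale1r. Qed.

Lemma pact_mulX i p q : pact ('X_i * p) q = mderiv i (pact p q).
Proof.
elim/mpolyind: p => [|c m p _ _ IHp]; first by rewrite mulr0 pact0l mderiv0.
rewrite mulrDr -scalerAr -mpolyXD !pactDl !pactZl !pactX IHp mderivD mderivZ.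
by rewrite addmC mderivmDm mderivmU1m.
Qed.

Lemma pact_is_linear p : linear (pact p).
Proof.
move=> a q1 q2; rewrite /pact scaler_sumr -big_split /=.
apply: eq_bigr => m _; rewrite mderivmD mderivmZ scalerDr !scalerA.
by rewrite mulrC.
Qed.

HB.instance Definition _ p :=
  GRing.isLinear.Build C P P _ (pact p) (pact_is_linear p).

Lemma pactZr c p q : pact p (c *: q) = c *: pact p q.
Proof. exact: linearZ. Qed.

Lemma pact_sumr (T : Type) (s : seq T) (F : T -> P) p :
  pact p (\sum_(t <- s) F t) = \sum_(t <- s) pact p (F t).
Proof. exact: raddf_sum. Qed.

Lemma odotE f g :
  odot f g = \sum_(J : {set 'I_r})
    ext_map (pact (f J)) (foldr (@contract r P) g (enum J)).
Proof.
rewrite /odot; apply: eq_bigr => J _; apply/ffunP => M.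
by rewrite !ext_mapE /pact sum_ffunE; apply: eq_bigr => m _; rewrite ffunE.
Qed.

Lemma ext_map_scale (h : {linear P -> P}) c g :
  ext_map h (ext_scale c%:MP g) = ext_scale c%:MP (ext_map h g).
Proof.
by apply/ffunP => J; rewrite !(ext_mapE, ext_scaleE) !mul_mpolyC linearZ.
Qed.

Definition pderiv i : superspace C r -> superspace C r := ext_map (mderiv i).

Lemma pderivE i u J : pderiv i u J = mderiv i (u J).
Proof. exact: ext_mapE. Qed.

Lemma pderivD i u1 u2 : pderiv i (u1 + u2) = pderiv i u1 + pderiv i u2.
Proof. by apply/ffunP => J; rewrite ffunE !ffunE mderivD. Qed.

Lemma pderiv_sum (T : Type) (s : seq T) (F : T -> superspace C r) i :
  pderiv i (\sum_(t <- s) F t) = \sum_(t <- s) pderiv i (F t).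
Proof.
apply: (big_morph (pderiv i)) => [x y|]; first by rewrite pderivD.
by apply/ffunP => J; rewrite !ffunE mderiv0.
Qed.

Lemma odot_mulX i f g : odot (ext_scale 'X_i f) g = pderiv i (odot f g).
Proof.
rewrite !odotE pderiv_sum; apply: eq_bigr => J _; apply/ffunP => M.
by rewrite pderivE !ext_mapE pact_mulX.
Qed.

Lemma odotDl f1 f2 g : odot (f1 + f2) g = odot f1 g + odot f2 g.
Proof.
rewrite !odotE -big_split /=; apply: eq_bigr => J _; apply/ffunP => M.
by rewrite [RHS]ffunE !ext_mapE ffunE pactDl.
Qed.

Lemma odot0l g : odot 0 g = 0.
Proof.
rewrite odotE big1 // => J _; apply/ffunP => M.
by rewrite ext_mapE !ffunE pact0l.
Qed.

Lemma odotZl c f g : odot (ext_scale c%:MP f) g = ext_scale c%:MP (odot f g).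
Proof.
rewrite !odotE ext_scale_sumr; apply: eq_bigr => J _; apply/ffunP => M.
by rewrite !ext_mapE !mul_mpolyC pactZl.
Qed.

Lemma odotNl f g : odot (- f) g = - odot f g.
Proof. by apply/eqP; rewrite -addr_eq0 -odotDl addNr odot0l. Qed.

Lemma odot1l g : odot (ext1 r P) g = g.
Proof.
rewrite odotE (bigD1 set0) //= big1 => [|J /negbTE J0].
  rewrite addr0 enum_set0; apply/ffunP => M; rewrite ext_mapE ffunE eqxx /=.
  by rewrite -mpolyX0 pactX mderivm0m.
by apply/ffunP => M; rewrite ext_mapE !ffunE J0 pact0l.
Qed.

Lemma ext_map_pactZ p a g : (a = 1 \/ a = -1) ->
  ext_map (pact (a * p)) g = ext_map (pact p) (ext_scale a g).
Proof.
case=> ->; apply/ffunP => M; rewrite !ext_mapE ?mulN1r ?mul1r //.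
by rewrite -scaleN1r pactZl -linearZ scaleN1r.
Qed.

Lemma esign_pm1 (A : comNzRingType) i (J : {set 'I_r}) :
  esign A i J = 1 \/ esign A i J = -1.
Proof.
apply: (big_rec (fun x : A => x = 1 \/ x = -1)) => [|k x _ [->|->]].
- by left.
- by rewrite mulr1; case: ifP; [right|left].
- by rewrite mulrN1; case: ifP; [left; rewrite opprK|right].
Qed.

Lemma contract_ext_map (h : {additive P -> P}) i u :
  contract i (ext_map h u) = ext_map h (contract i u).
Proof.
apply/ffunP => J; rewrite ext_mapE !contractE ext_mapE.
case: ifP => _; first by rewrite raddf0.
by have [->|->] := esign_pm1 P i J; rewrite ?mul1r // !mulN1r raddfN.
Qed.

Lemma wedge_gen_ext_map (h : {additive P -> P}) i u :
  wedge (ext_gen P i) (ext_map h u) = ext_map h (wedge (ext_gen P i) u).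
Proof.
apply/ffunP => J; rewrite ext_mapE !wedge_genE ext_mapE.
case: ifP => _; last by rewrite raddf0.
by have [->|->] := esign_pm1 P i J; rewrite ?mul1r // !mulN1r raddfN.
Qed.

(** [foldr] puts the contraction by the smallest index outermost, so a wedge product of generators
    acts by the composite of their contractions in the same order. Together with [odot_mulX] this
    determines [odot] by its values on generators. *)
Lemma odot_wedge_gen i f g :
  odot (wedge (ext_gen P i) f) g = contract i (odot f g).
Proof.
rewrite !odotE contract_sum (bigID (fun J : {set 'I_r} => i \in J)) /=.
rewrite [X in _ + X]big1 ?addr0 => [|J iJ]; last first.
  by apply/ffunP => M; rewrite ext_mapE wedge_genE (negbTE iJ) pact0l ffunE.
rewrite [RHS](bigID (fun J : {set 'I_r} => i \in J)) /=.
rewrite [X in X + _]big1 ?add0r => [|J iJ]; last first.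
  rewrite contract_ext_map contract_foldr_enum iJ.
  by apply/ffunP => M; rewrite ext_mapE !ffunE raddf0.
(* Only sets containing [i] survive on the left and only sets avoiding [i] on the right; adding [i]
   matches them. *)
rewrite (reindex_onto (fun J => i |: J) (fun J => J :\ i)) /=; last first.
  by move=> J iJ; rewrite setD1K.
apply: eq_big => [J|J].
  rewrite setU11 /=; apply/eqP/idP => [<-|/setU1K -> //].
  by rewrite !inE eqxx.
rewrite setU11 => /eqP defJ; have iJ: i \notin J by rewrite -defJ !inE eqxx.
rewrite contract_ext_map contract_foldr_enum (negbTE iJ) wedge_genE setU11.
by rewrite esignU1_id setU1K // ext_map_pactZ //; exact: esign_pm1.
Qed.

(** Left multiplications by generators and by constants, together with sums, produce all of
    superspace from 1. Identities for [odot f g] can therefore be checked one generator of [f] at a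
    time. *)
Lemma superspace_ind (Q : superspace C r -> Prop) :
  (forall f g, Q f -> Q g -> Q (f + g)) ->
  (forall c f, Q f -> Q (ext_scale c%:MP f)) ->
  (forall i f, Q f -> Q (ext_scale 'X_i f)) ->
  (forall i f, Q f -> Q (wedge (ext_gen P i) f)) ->
  Q (ext1 r P) -> forall f, Q f.
Proof.
move=> QD QZ QX Qw Q1 f.
have Q0 : Q 0 by rewrite -(ext_scale0l (ext1 r P)) -(mpolyC0 r C); exact: QZ.
pose e (J : {set 'I_r}) : superspace C r := [ffun M => (M == J)%:R].
have Qe J : Q (e J).
  have [k] := ubnP #|J|; elim: k J => // k IHk J.
  have [->|[i iJ]] := set_0Vmem J; first by rewrite (_ : e _ = ext1 r P).
  rewrite (cardsD1 i) iJ ltnS => /IHk/(Qw i).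
  suff -> : e J = ext_scale (esign P i J) (wedge (ext_gen P i) (e (J :\ i))).
    have [->|->] := esign_pm1 P i J; first by rewrite ext_scale1.
    by rewrite -mpolyC1 -mpolyCN; exact: QZ.
  apply/ffunP => M; rewrite ext_scaleE wedge_genE !ffunE.
  case: ifPn => iM; last first.
    by rewrite mulr0 (negbTE (contraNneq _ iM)) // => ->.
  have -> : (M :\ i == J :\ i) = (M == J).
    by apply/eqP/eqP => [eqMJ|->] //; rewrite -(setD1K iM) eqMJ setD1K.
  by case: eqP => [->|_]; rewrite ?mulr0 // mulrA esign_sqr mulr1.
have QXm m u : Q u -> Q (ext_scale 'X_[m] u).
  rewrite mpolyXE_id; move: u.
  apply: (big_ind (fun p : P => forall u, Q u -> Q (ext_scale p u))).
  - by move=> u; rewrite ext_scale1.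
  - by move=> p1 p2 Qp1 Qp2 u Qu; rewrite -ext_scaleA; apply/Qp1/Qp2.
  move=> i _; elim: (m i) => [|k IHk] u Qu; first by rewrite expr0 ext_scale1.
  by rewrite exprS -ext_scaleA; apply/QX/IHk.
have Qpe p J : Q (ext_scale p (e J)).
  elim/mpolyind: p => [|c m p _ _ IHp]; first by rewrite ext_scale0l.
  rewrite ext_scaleDl; apply: QD => //; rewrite -mul_mpolyC -ext_scaleA.
  exact/QZ/QXm.
have -> : f = \sum_J ext_scale (f J) (e J).
  apply/ffunP => M; rewrite sum_ffunE (bigD1 M) //= big1 => [|J neq_JM].
    by rewrite ext_scaleE ffunE eqxx mulr1 addr0.
  by rewrite ext_scaleE ffunE eq_sym (negbTE neq_JM) mulr0.
by apply: big_ind.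
Qed.

End PolynomialAction.

(** * The Koszul operator *)

Section Separation.
Variables (F : fieldType) (n : nat).
Implicit Types (W : set 'rV[F]_n) (v w : 'rV[F]_n).

(** [W] is a subspace given only as a predicate. A matrix of maximal rank with row space inside [W]
    must have row space exactly [W]; some column of its cokernel matrix then detects [v]. *)
Lemma separating_covector W v :
  W 0 -> (forall a u w, W u -> W w -> W (a *: u + w)) -> ~ W v ->
  exists2 c : 'cV[F]_n, (forall w, W w -> w *m c = 0) & v *m c != 0.
Proof.
move=> W0 Wlin Wv.
pose spanned k := `[< exists2 M : 'M[F]_n, forall u, W (u *m M) & \rank M = k
  >].
have sp0 : exists k, spanned k.
  by exists 0%N; apply/asboolP; exists 0; rewrite ?mxrank0 // => u;
    rewrite mulmx0.
have sp_le k : spanned k -> (k <= n)%N by case/asboolP => M _ <-;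
  exact: rank_leq_row.
case: (ex_maxnP sp0 sp_le) => k /asboolP[M WM rM] kmax.
have sWM w : W w -> (w <= M)%MS.
  move=> Ww; have : (\rank (w + M)%MS <= \rank M)%N.
    rewrite rM; apply: kmax; apply/asboolP; exists (w + M)%MS => // u.
    have /sub_addsmxP[[u1 u2] /= ->] : (u *m (w + M)%MS <= w + M)%MS
      by exact: submxMl.
    have -> : u1 *m w = u1 0 0 *: w by rewrite [u1]mx11_scalar mul_scalar_mx
      !mxE.
    exact: Wlin.
  by rewrite (geq_leqif (mxrank_leqif_sup (addsmxSr w M))) addsmx_sub =>
    /andP[].
have vM : v *m cokermx M != 0.
  by apply: contra_not_neq Wv => /eqP; rewrite -submxE => /submxP[u ->];
    exact: WM.
have [j vj] : exists j, (v *m cokermx M) 0 j != 0.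
  apply/existsP; apply: contraNT vM; rewrite negb_exists => /forallP v0.
  by apply/eqP/rowP => j; rewrite [RHS]mxE; apply/eqP;
    rewrite -[_ == _]negbK v0.
exists (col j (cokermx M)) => [w /sWM|].
  by rewrite submxE colE mulmxA => /eqP ->; rewrite mul0mx.
by apply: contra_neq vj; rewrite colE mulmxA -colE => /colP/(_ 0); rewrite !mxE.
Qed.
End Separation.

Section Koszul.
Variables (C : fieldType) (r : nat).
Local Notation P := {mpoly C[r]}.
Local Notation theta := (fun i => wedge (ext_gen P i)).
Local Notation iota := (@contract r P).
Implicit Types (i j : 'I_r) (f g u : superspace C r).

(** Contraction with the Euler vector field, that is, the Koszul differential. It is used on both
    superspaces, which share one type. *)
Definition koszul f : superspace C r := \sum_(i < r) ext_scale 'X_i (iota i f).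

(** The grading involution: the sign picked up when an odd operator is moved past [f]. *)
Definition parity f : superspace C r := [ffun J : {set 'I_r} =>
  (-1) ^+ #|J| * f J].

Lemma koszulD f g : koszul (f + g) = koszul f + koszul g.
Proof.
rewrite -big_split; apply: eq_bigr => i _.
by rewrite contractD ext_scaleDr.
Qed.

Lemma koszulZ p f : koszul (ext_scale p f) = ext_scale p (koszul f).
Proof.
rewrite /koszul ext_scale_sumr; apply: eq_bigr => i _.
by rewrite contractZ !ext_scaleA mulrC.
Qed.

Lemma koszul0 : koszul 0 = 0.
Proof. by have := koszulZ 0 0; rewrite !ext_scale0l. Qed.

Lemma koszul1 : koszul (ext1 r P) = 0.
Proof.
apply: big1 => i _; apply/ffunP => J.
rewrite ext_scaleE contractE [RHS]ffunE /ext1 ffunE.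
case: eqP => [/setP/(_ i)|_]; first by rewrite !inE eqxx.
by rewrite mulr0 if_same mulr0.
Qed.

Lemma koszul_theta i f :
  koszul (theta i f) = ext_scale 'X_i f - theta i (koszul f).
Proof.
rewrite /koszul wedge_sumr -sumrN.
rewrite (bigD1 i) //= [in RHS](bigD1 i) //= addrA; congr (_ + _).
  by rewrite contract_wedge_gen eqxx ext_scaleDr ext_scaleNr wedgeZr.
apply: eq_bigr => j ji; rewrite contract_wedge_gen eq_sym (negbTE ji) sub0r.
by rewrite ext_scaleNr wedgeZr.
Qed.

Lemma koszul_iota i f : koszul (iota i f) = - iota i (koszul f).
Proof.
rewrite /koszul contract_sum -sumrN; apply: eq_bigr => j _.
by rewrite contract_anti ext_scaleNr contractZ.
Qed.

Lemma pderiv_mulX i j f :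
  pderiv i (ext_scale 'X_j f) =
  (if i == j then f else 0) + ext_scale 'X_j (pderiv i f).
Proof.
apply/ffunP => J; rewrite [RHS]ffunE pderivE !ext_scaleE pderivE mderivM.
congr (_ + _); rewrite mderivX.
have [<-|neq_ij] := eqVneq i j.
  rewrite mnm1E eqxx scale1r (_ : U_(i) - U_(i) = 0)%MM ?mpolyX0 ?mul1r //.
  by apply/mnmP => k; rewrite mnmBE subnn mnm0E.
by rewrite mnm1E eq_sym (negbTE neq_ij) scale0r mul0r ffunE.
Qed.

Lemma koszul_pderiv i f : koszul (pderiv i f) = pderiv i (koszul f) - iota i f.
Proof.
apply/eqP; rewrite eq_sym subr_eq /koszul pderiv_sum; apply/eqP.
rewrite (bigD1 i) //= [in RHS](bigD1 i) //= addrAC; congr (_ + _).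
  by rewrite pderiv_mulX eqxx addrC contract_ext_map.
by apply: eq_bigr => j ji; rewrite pderiv_mulX eq_sym (negbTE ji) add0r
  contract_ext_map.
Qed.

Lemma pderivB i f g : pderiv i (f - g) = pderiv i f - pderiv i g.
Proof. by apply/ffunP => J; rewrite !ffunE mderivB. Qed.

Lemma superdE f : superd f = \sum_(i < r) theta i (pderiv i f).
Proof. by []. Qed.

Lemma superdD f g : superd (f + g) = superd f + superd g.
Proof.
rewrite -big_split; apply: eq_bigr => i _.
by rewrite -/(pderiv i _) pderivD wedgeDr.
Qed.

Lemma superdZ c f : superd (ext_scale c%:MP f) = ext_scale c%:MP (superd f).
Proof.
rewrite !superdE ext_scale_sumr; apply: eq_bigr => i _.
by rewrite /pderiv ext_map_scale wedgeZr.
Qed.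

Lemma superd0 : superd 0 = 0 :> superspace C r.
Proof. by have := superdZ 0 0; rewrite mpolyC0 !ext_scale0l. Qed.

Lemma superdN f : superd (- f) = - superd f.
Proof. by apply/eqP; rewrite -addr_eq0 -superdD addNr superd0. Qed.

Lemma superd_sum (T : Type) (s : seq T) (F : T -> superspace C r) :
  superd (\sum_(t <- s) F t) = \sum_(t <- s) superd (F t).
Proof. by apply: (big_morph (@superd C r));
  [exact: superdD|exact: superd0]. Qed.

Lemma superd_mulX i f :
  superd (ext_scale 'X_i f) = theta i f + ext_scale 'X_i (superd f).
Proof.
rewrite !superdE ext_scale_sumr.
rewrite (bigD1 i) //= [in RHS](bigD1 i) //= addrA; congr (_ + _).
  by rewrite pderiv_mulX eqxx wedgeDr wedgeZr.
by apply: eq_bigr => j ji; rewrite pderiv_mulX (negbTE ji) add0r wedgeZr.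
Qed.

Lemma superd_theta i f : superd (theta i f) = - theta i (superd f).
Proof.
rewrite !superdE wedge_sumr -sumrN; apply: eq_bigr => j _.
by rewrite /pderiv -wedge_gen_ext_map wedge_gen_anti.
Qed.

Lemma superd_pderiv i f : superd (pderiv i f) = pderiv i (superd f).
Proof.
rewrite !superdE pderiv_sum; apply: eq_bigr => j _.
rewrite /pderiv -wedge_gen_ext_map; congr wedge; apply/ffunP => J.
by rewrite !ext_mapE mderiv_comm.
Qed.

Lemma superd_iota i f : superd (iota i f) = pderiv i f - iota i (superd f).
Proof.
rewrite !superdE contract_sum -sumrN.
rewrite (bigD1 i) //= [in RHS](bigD1 i) //= addrA; congr (_ + _).
  by rewrite contract_wedge_gen eqxx subKr /pderiv contract_ext_map.
apply: eq_bigr => j ji; rewrite contract_wedge_gen (negbTE ji) sub0r opprK.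
by rewrite /pderiv contract_ext_map.
Qed.

Lemma superd1 : superd (ext1 r P) = 0.
Proof.
apply: big1 => i _; rewrite (_ : ext_map _ _ = 0) ?wedge0r //.
by apply/ffunP => J; rewrite !ffunE; case: eqP => _;
  rewrite ?mderiv0 // -mpolyC1 mderivC.
Qed.

Lemma parityD f g : parity (f + g) = parity f + parity g.
Proof. by apply/ffunP => J; rewrite !ffunE mulrDr. Qed.

Lemma parityZ p f : parity (ext_scale p f) = ext_scale p (parity f).
Proof. by apply/ffunP => J; rewrite !ffunE mulrCA. Qed.

Lemma parity_theta i f : parity (theta i f) = - theta i (parity f).
Proof.
apply/ffunP => J; rewrite ffunE [RHS]ffunE !wedge_genE.
case: ifPn => iJ; last by rewrite mulr0 oppr0.
by rewrite ffunE (cardsD1 i J) iJ exprS; ring.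
Qed.

Lemma parity1 : parity (ext1 r P) = ext1 r P.
Proof.
apply/ffunP => J; rewrite !ffunE; case: eqP => [->|_]; last by rewrite mulr0.
by rewrite cards0 mulr1.
Qed.

(** [koszul] and [superd] are transposes of each other up to [parity]. In the induction,
    [koszul_theta] is matched with [superd_iota], since a generator acts on [g] by contraction. If
    both [g] and [superd g] annihilate an ideal containing [f] and [parity f], then [koszul f]
    annihilates [g]. *)
Lemma odot_koszul f g :
  odot (koszul f) g = superd (odot f g) - odot (parity f) (superd g).
Proof.
elim/superspace_ind: f => [f1 f2 IH1 IH2|c f IHf|i f IHf|i f IHf|].
- rewrite koszulD parityD !odotDl IH1 IH2 superdD.
  by rewrite opprD addrACA.
- rewrite koszulZ parityZ !odotZl IHf superdZ.
  by rewrite ext_scaleDr ext_scaleNr.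
- rewrite koszulZ parityZ !odot_mulX IHf superd_pderiv.
  by rewrite pderivB.
- rewrite koszul_theta parity_theta odotDl !odotNl !odot_wedge_gen odot_mulX
  IHf.
  by rewrite superd_iota contractD contractN opprB opprK addrA addrAC.
by rewrite koszul1 parity1 odot0l !odot1l subrr.
Qed.

(** The mirror image of [odot_koszul]: here [superd_mulX] is matched with [koszul_pderiv], and
    [superd_theta] with [koszul_iota]. *)
Lemma odot_superd f g :
  odot (superd f) g = odot (parity f) (koszul g) - koszul (odot f g).
Proof.
elim/superspace_ind: f => [f1 f2 IH1 IH2|c f IHf|i f IHf|i f IHf|].
- rewrite superdD parityD !odotDl IH1 IH2 koszulD.
  by rewrite opprD addrACA.
- rewrite superdZ parityZ !odotZl IHf koszulZ.
  by rewrite ext_scaleDr ext_scaleNr.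
- rewrite superd_mulX parityZ odotDl !odot_mulX odot_wedge_gen IHf
  koszul_pderiv.
  by rewrite pderivB opprB addrCA.
- rewrite superd_theta parity_theta !odotNl !odot_wedge_gen IHf koszul_iota.
  by rewrite contractD contractN opprD.
by rewrite superd1 parity1 odot0l !odot1l subrr.
Qed.

Lemma theta_iota_sum f :
  \sum_(i < r) theta i (iota i f) =
  [ffun J : {set 'I_r} => f J *+ #|J|].
Proof.
apply/ffunP => J; rewrite sum_ffunE ffunE -sumr_const [RHS]big_mkcond /=.
apply: eq_bigr => i _; rewrite wedge_genE contractE !inE eqxx /=.
case: ifPn => iJ //; rewrite setD1K // esignD1_id mulrA esign_sqr.
by rewrite mul1r.
Qed.

Lemma euler_mderiv (p : P) (m : 'X_{1..r}) :
  (\sum_(i < r) 'X_i * mderiv i p)@_m = p@_m *+ mdeg m.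
Proof.
rewrite raddf_sum mdegE -sumrMnr; apply: eq_bigr => i _ /=.
elim/mpolyind: p => [|c m' p _ _ IHp]; first by rewrite mderiv0 mulr0 !mcoeff0
  mul0rn.
rewrite mderivD mderivZ mulrDr !mcoeffD mulrnDl {}IHp; congr (_ + _).
have -> : 'X_i * (c *: mderiv i 'X_[m']) = (c * (m' i)%:R) *: 'X_[m'] :> P.
  rewrite mderivX scalerA -scalerAr -mpolyXD.
  have [->|m'i] := posnP (m' i); first by rewrite mulr0 !scale0r.
  congr (_ *: 'X_[_]); apply/mnmP => j; rewrite mnmDE mnmBE mnm1E.
  by case: eqVneq => [<-|_]; rewrite ?subnKC ?subn0.
rewrite !mcoeffZ mcoeffX; case: eqP => [->|_]; last by rewrite !mulr0 mul0rn.
by rewrite !mulr1 mulr_natr.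
Qed.

(** The mixed terms from [superd_mulX] and [superd_iota] cancel against [koszul (superd f)]. What
    remains is the Euler operator on coefficients, which counts [mdeg m], and the sum of
    wedge-contract products, which counts [#|J|]. *)
Lemma cartan_koszul f J m :
  ((superd (koszul f) + koszul (superd f)) J)@_m =
  (f J)@_m *+ (mdeg m + #|J|).
Proof.
have -> : superd (koszul f) + koszul (superd f) =
    \sum_(i < r) ext_scale 'X_i (pderiv i f) + \sum_(i < r) theta i (iota i f).
  rewrite {1}/koszul.
  rewrite superd_sum.
  rewrite -!big_split /=; apply: eq_bigr => i _.
  rewrite superd_mulX superd_iota ext_scaleDr ext_scaleNr.
  by rewrite -addrA subrK addrC.
rewrite theta_iota_sum ffunE mcoeffD ffunE raddfMn /= mulrnDr; congr (_ + _).
rewrite -euler_mderiv sum_ffunE; congr mcoeff; apply: eq_bigr => i _.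
by rewrite ext_scaleE pderivE.
Qed.

End Koszul.

(** * Inverse systems *)

Section InverseSystemDuality.
Variables (C : numFieldType) (r : nat).
Local Notation P := {mpoly C[r]}.
Local Notation iota := (@contract r P).
Implicit Types (i j : 'I_r) (J M : {set 'I_r}) (f g h u : superspace C r).
Implicit Types (I : set (superspace C r)).

Lemma mcoeff_pihomog d (p : P) (m : 'X_{1..r}) :
  (pihomog mdeg d p)@_m = if mdeg m == d then p@_m else 0.
Proof.
elim/mpolyind: p => [|c m' p _ _ IHp]; first by rewrite pihomog0 !mcoeff0
  if_same.
rewrite pihomogD linearZ /= pihomogX !mcoeffD {}IHp !mcoeffZ.
have -> : (if mdeg m' == d then 'X_[m'] else 0 : P)@_m =
          if mdeg m == d then ('X_[m'] : P)@_m else 0.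
  case: (m' =P m) => [->|/eqP/negbTE ne]; first by case: ifP; rewrite ?mcoeff0.
  by rewrite mcoeffX ne; case: ifP => _; rewrite ?mcoeff0 ?mcoeffX ?ne //
    if_same.
by case: ifP; rewrite ?mulr0 ?addr0.
Qed.

Lemma bicomponentE a b f J (m : 'X_{1..r}) :
  (bicomponent a b f J)@_m =
  if (#|J| == b) && (mdeg m == a) then (f J)@_m else 0.
Proof.
rewrite /bicomponent ffunE; case: eqP => _ /=; last by rewrite mcoeff0.
by rewrite ffunE mcoeff_pihomog.
Qed.

Lemma superspaceP f g :
  (forall J (m : 'X_{1..r}), (f J)@_m = (g J)@_m) -> f = g.
Proof. by move=> eq_fg; apply/ffunP => J; apply/mpolyP => m. Qed.

Lemma superspace_bound f :
  exists N, forall J (m : 'X_{1..r}), (N <= mdeg m)%N -> (f J)@_m = 0.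
Proof.
exists (\max_(J : {set 'I_r}) msize (f J)) => J m le_Nm.
apply: memN_msupp_eq0; apply: msize_mdeg_ge; apply: leq_trans le_Nm.
exact: leq_bigmax.
Qed.

Section Ideal.
Variable (I : set (superspace C r)).
Hypothesis idealI : bigraded_ideal I.

Lemma ideal0 : I 0. Proof. by case: idealI. Qed.

Lemma idealD f g : I f -> I g -> I (f + g). Proof. by case: idealI => _ + _ _;
  exact. Qed.

Lemma ideal_wedge f g : I g -> I (wedge f g).
Proof. by case: idealI => _ _ H _ /(H f)[]. Qed.

Lemma idealZ p f : I f -> I (ext_scale p f).
Proof. by move=> /(ideal_wedge (ext_scale p (ext1 r P)));
  rewrite wedgeZl wedge1l. Qed.

(** An element has only finitely many bihomogeneous components, each of them in the ideal, so any
    rescaling by bidegree stays in [I]. This serves for the signs of [parity] and for truncation by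
    degree. *)
Lemma ideal_reweight (w : nat -> nat -> C) f h : I f ->
  (forall J (m : 'X_{1..r}), (h J)@_m = w (mdeg m) #|J| * (f J)@_m) -> I h.
Proof.
move=> If hE; have [N fN] := superspace_bound f.
suff -> : h = \sum_(a < N) \sum_(b < r.+1)
            ext_scale (w a b)%:MP (bicomponent a b f).
  apply: (big_ind I) => [|x y|a _]; [exact: ideal0|exact: idealD|].
  apply: (big_ind I) => [|x y|b _]; [exact: ideal0|exact: idealD|].
  by apply: idealZ; case: idealI => _ _ _; apply.
apply: superspaceP => J m; rewrite hE sum_ffunE raddf_sum /=.
have coefE a b : (ext_scale (w a b)%:MP (bicomponent a b f) J)@_m =
    if (#|J| == b) && (mdeg m == a) then w a b * (f J)@_m else 0.
  rewrite ext_scaleE mcoeffCM bicomponentE.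
  by case: ifP; rewrite ?mulr0.
have ltJ : (#|J| < r.+1)%N by rewrite ltnS (leq_trans (max_card _)) ?card_ord.
have [lt_mN|/fN fm0] := ltnP (mdeg m) N; last first.
  rewrite fm0 mulr0 big1 // => a _; rewrite sum_ffunE raddf_sum big1 //= => b _.
  by rewrite coefE fm0 mulr0 if_same.
rewrite (bigD1 (Ordinal lt_mN)) //= [X in _ + X]big1 => [|a neq_a]; last first.
  rewrite sum_ffunE raddf_sum big1 //= => b _; rewrite coefE.
  by rewrite [mdeg m == a]eq_sym (negbTE (neq_a : a != mdeg m :> nat)) andbF.
rewrite sum_ffunE raddf_sum (bigD1 (Ordinal ltJ)) //= coefE !eqxx /= big1 ?addr0
  //.
by move=> b neq_b; rewrite coefE eq_sym (negbTE (neq_b : b != #|J| :> nat)).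
Qed.

Lemma ideal_parity f : I f -> I (parity f).
Proof.
move=> /(@ideal_reweight (fun _ b => (-1) ^+ b)); apply=> J m.
by rewrite ffunE -mcoeffCM; congr mcoeff; rewrite rmorphXn rmorphN rmorph1.
Qed.

End Ideal.

(** The sign accumulated when the coefficient at [M] is read off after contracting along [s]. *)
Fixpoint csign (s : seq 'I_r) M : P :=
  if s is i :: s' then esign P i M * csign s' (i |: M) else 1.

Lemma csign_sqr s M : csign s M * csign s M = 1.
Proof.
by elim: s M => [|i s IHs] M /=; rewrite ?mulr1 // mulrACA esign_sqr IHs mulr1.
Qed.

Lemma foldr_contractE s g M : uniq s -> [disjoint s & M] ->
  foldr iota g s M = csign s M * g ([set:: s] :|: M).
Proof.
elim: s M => [|i s IHs] M /=; first by rewrite mul1r set_nil set0U.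
case/andP=> is_ us; rewrite disjoint_has /= => /norP[iM sM].
rewrite contractE (negbTE iM) IHs //; last first.
  rewrite disjoint_has; apply/hasPn => j js /=; rewrite !inE negb_or.
  rewrite (hasPn sM) // andbT; apply: contraNneq is_ => <-.
  exact: js.
by rewrite mulrA set_cons setUCA setUA.
Qed.

Lemma odot_const f g :
  odot f g set0 = \sum_(J : {set 'I_r})
    pact (f J) (csign (enum J) set0 * g J).
Proof.
rewrite odotE sum_ffunE; apply: eq_bigr => J _; rewrite ext_mapE.
rewrite foldr_contractE ?enum_uniq ?setU0 //; last first.
  by rewrite disjoint_has; apply/hasPn => j _; rewrite inE.
by congr (pact _ (_ * g _)); apply/setP => j; rewrite !inE mem_enum.
Qed.

(** The multi-index factorial, i.e. the value of the operator [mderivm m] on the monomial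
    ['X_[m]]. *)
Definition mfact (m : 'X_{1..r}) : nat := \prod_(i < r) (m i)`!.

Lemma mcoeff_pactX0 (p : P) (m : 'X_{1..r}) :
  (pact p 'X_[m])@_0 = p@_m *+ mfact m.
Proof.
elim/mpolyind: p => [|c m' p _ _ IHp]; first by rewrite pact0l !mcoeff0 mul0rn.
rewrite pactDl pactZl pactX !mcoeffD !mcoeffZ {}IHp mulrnDl; congr (_ + _).
rewrite mcoeff_mderivm addm0 !mcoeffX [m' == m]eq_sym.
case: eqP => [<-|_]; last by rewrite !mulr0 !mul0rn mulr0.
rewrite mulr1 mulr_natr; congr (_ *+ _); apply: eq_bigr => i _.
by rewrite ffactnn.
Qed.

(** Every coefficient of [odot h g] is, up to a sign and a nonzero integer, the constant term for a
    multiple of [h]: multiplying by an odd generator removes an element of [J], multiplying by a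
    variable lowers [m]. For an ideal, annihilation thus only has to be tested on constant terms. *)
Lemma odot_eq0 (Q : superspace C r -> Prop) g :
  (forall p h, Q h -> Q (ext_scale p h)) ->
  (forall i h, Q h -> Q (wedge (ext_gen P i) h)) ->
  (forall h, Q h -> (odot h g set0)@_0 = 0) ->
  forall h, Q h -> odot h g = 0.
Proof.
move=> QZ Qw Q0 h Qh; apply: superspaceP => J m; rewrite ffunE mcoeff0.
have [k] := ubnP (#|J| + mdeg m); elim: k => // k IHk in J m h Qh *.
rewrite ltnS => le_k.
have [J0|[i iJ]] := set_0Vmem J; last first.
  have /(_ _ (Qw i _ Qh)) := IHk (J :\ i) m.
  rewrite odot_wedge_gen contractE !inE eqxx /= setD1K //.
  have -> // : (#|J :\ i| + mdeg m < k)%N.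
    by apply: leq_trans le_k; rewrite [in X in (_ < X)%N](cardsD1 i J) iJ.
  move=> /(_ isT) E; have [e1|e1] := esign_pm1 P i (J :\ i); move: E;
    rewrite e1.
    by rewrite mul1r.
  by rewrite mulN1r mcoeffN => /eqP; rewrite oppr_eq0 => /eqP.
have [->|m0] := eqVneq m 0%MM; first by rewrite J0 Q0.
have [i mi] : exists i, (0 < m i)%N.
  apply/existsP; apply: contraNT m0; rewrite negb_exists => /forallP mi.
  by apply/eqP/mnmP => i; rewrite mnm0E; apply/eqP; rewrite -leqn0 leqNgt.
have mE : (m = (m - U_(i)) + U_(i))%MM.
  by rewrite submK //; apply/mnm_lepP => j; rewrite mnm1E; case: eqP => [<-|].
have := IHk J (m - U_(i))%MM _ (QZ 'X_i _ Qh).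
rewrite odot_mulX pderivE mcoeff_mderiv -mE => /(_ _)/eqP.
(* Differentiating multiplies the coefficient by the exponent [m i], which is nonzero in
   characteristic 0. *)
rewrite mulrn_eq0 /= => /(_ _)/eqP; apply.
by apply: leq_trans le_k; rewrite [in X in (_ < X)%N]mE mdegD mdeg1 addn1 addnS.
Qed.

(** If [f] is not in [I], its coefficients in degrees below [N] are separated by a covector [c] from
    those of all elements of [I]. The covector is realized as the pairing with an element [g] of the
    inverse system, contradicting that [g] is annihilated by [f]. *)
Lemma ideal_double_annihilator I f : bigraded_ideal I ->
  (forall g, inverse_system I g -> odot f g = 0) -> I f.
Proof.
move=> idealI annf; apply: contrapT => nIf.
have [N fN] := superspace_bound f.
pose T : finType := ({set 'I_r} * 'X_{1..r < N})%type.
pose coefs h : 'rV[C]_#|T| := \row_t (h (enum_val t).1)@_(bmnm (enum_val t).2).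
pose W : set 'rV[C]_#|T| := [set coefs h | h in I]%classic.
have coefsE h J (m : 'X_{1..r < N}) : coefs h 0 (enum_rank (J, m)) = (h J)@_m.
  by rewrite mxE enum_rankK.
have [c W_c f_c] : exists2 c : 'cV[C]_#|T|,
    (forall w, W w -> w *m c = 0) & coefs f *m c != 0.
  apply: separating_covector => [|a _ _ [u Iu <-] [w Iw <-]|[h Ih eq_hf]].
  - by exists 0; [exact: ideal0|apply/rowP => t; rewrite !mxE ffunE mcoeff0].
  - exists (ext_scale a%:MP u + w); first exact: idealD (idealZ _ _ _) _.
    by apply/rowP => t; rewrite !mxE ffunE ext_scaleE mcoeffD mcoeffCM.
  (* The weight truncates [h] to degrees below [N]; there [h] agrees with [f], and [f] has nothing
     beyond. *)
  apply: nIf; apply: (ideal_reweight (w := fun a _ =>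
    (a < N)%N%:R) idealI Ih) => J m.
  case: ltnP => [lt_mN|/fN->]; last by rewrite mul0r.
  by rewrite mul1r -!(coefsE _ _ (BMultinom lt_mN)) eq_hf.
(* Dividing by [mfact m] undoes the factor coming from differentiation, and [csign] squares to 1, so
   pairing with [g] is the functional [c]. *)
pose g : superspace C r := [ffun J : {set 'I_r} => csign (enum J) set0 *
  \sum_(m : 'X_{1..r < N}) (c (enum_rank (J, m)) 0 / (mfact m)%:R) *: 'X_[m]].
have pairE h : (odot h g set0)@_0 = (coefs h *m c) 0 0.
  transitivity (\sum_(J : {set 'I_r}) \sum_(m : 'X_{1..r < N})
      (h J)@_m * c (enum_rank (J, m)) 0); last first.
    rewrite pair_bigA mxE [RHS](reindex (@enum_rank T)) /=; last first.
      by apply: onW_bij; exact: enum_rank_bij.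
    by apply: eq_bigr => -[J m] _; rewrite coefsE.
  rewrite odot_const raddf_sum.
  apply: eq_bigr => J _; rewrite ffunE mulrA csign_sqr mul1r.
  rewrite pact_sumr raddf_sum.
  apply: eq_bigr => m _; rewrite /= pactZr mcoeffZ mcoeff_pactX0.
  rewrite -[(h J)@__ *+ _]mulr_natr mulrACA mulVf ?mulr1 1?mulrC //.
  by rewrite pnatr_eq0 -lt0n prodn_gt0 // => i; exact: fact_gt0.
suff /annf odot_fg : inverse_system I g.
  move/eqP: f_c; apply; apply/rowP => t; rewrite !ord1.
  by rewrite -pairE odot_fg ffunE mcoeff0 mxE.
move=> h; apply: odot_eq0 => {h} [p h|i h|h Ih]; first exact: idealZ.
  exact: ideal_wedge.
by rewrite pairE W_c ?mxE //; exists h.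
Qed.

(** [superd] anticommutes with wedging by a generator and commutes with partial derivatives, so the
    square equals its own negative, and 2 is invertible. *)
Lemma superd_superd f : superd (superd f) = 0.
Proof.
have /eqP : superd (superd f) = - superd (superd f).
  transitivity (\sum_i superd (wedge (ext_gen P i) (pderiv i f))).
    by rewrite -superd_sum.
  rewrite superdE -sumrN.
  by apply: eq_bigr => i _; rewrite superd_theta superd_pderiv.
rewrite -subr_eq0 opprK => /eqP dd0; apply: superspaceP => J m.
move/ffunP/(_ J)/(congr1 (mcoeff m))/eqP: dd0; rewrite !ffunE mcoeffD mcoeff0.
by rewrite -mulr2n mulrn_eq0 /= => /eqP.
Qed.

Lemma koszul_bihomog (a b : int) f :
  bihomog a b f -> bihomog (a + 1) (b - 1) (koszul f).
Proof.
move=> hom_f J m; rewrite mcoeff_msupp sum_ffunE raddf_sum => sum_n0.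
have [i im] : exists i : 'I_r, (('X_i * iota i f J : P)@_m != 0).
  apply/existsP; apply: contraNT sum_n0; rewrite negb_exists => /forallP z.
  rewrite big1 // => i _; rewrite ext_scaleE; apply/eqP.
  by rewrite -[_ == _]negbK z.
move: im; rewrite contractE; case: ifPn => iJ;
  first by rewrite mulr0 mcoeff0 eqxx.
have [e1|e1] := esign_pm1 P i J; rewrite e1 ?mul1r ?mulN1r ?mulrN ?mcoeffN
  ?oppr_eq0.
all: rewrite mulrC -mcoeff_msupp (perm_mem (msuppMX _ _)) =>
  /mapP[m' /hom_f[<- <-] ->].
all: by rewrite mdegD mdeg1 cardsU1 iJ; split; lia.
Qed.

Theorem koszul_exact I : bigraded_ideal I ->
  (forall g, inverse_system I g -> inverse_system I (superd g)) ->
  (forall g, inverse_system I g -> inverse_system I (koszul g)) ->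
  inverse_system I (ext1 r P) ->
  forall a b : int, exact_mod I a b <-> (a, b) <> (0, 0).
Proof.
move=> idealI Sd SK S1 a b.
have IK f : I f -> I (koszul f).
  move=> If; apply: ideal_double_annihilator => // g Sg.
  rewrite odot_koszul (Sg _ If) (Sd _ Sg _ (ideal_parity idealI If)).
  by rewrite superd0 subr0.
have Id f : I f -> I (superd f).
  move=> If; apply: ideal_double_annihilator => // g Sg.
  rewrite odot_superd (Sg _ If) (SK _ Sg _ (ideal_parity idealI If)).
  by rewrite koszul0 subr0.
split=> [+ [a0 b0]|neq0 f hom_f].
  rewrite {}a0 {}b0 => exact_ab.
  have [||g hom_g] := (exact_ab (ext1 r P) _).1; rewrite ?superd1.
  - move=> J m; rewrite ffunE; case: eqP => [->|_]; last by rewrite msupp0.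
    by rewrite msupp1 inE => /eqP ->; rewrite mdeg0 cards0.
  - exact: ideal0.
  (* The bidegree of [g] is [(1, -1)], and no set has cardinality -1. Hence 1 would lie in [I],
     although it acts as the identity on the element 1 of the inverse system. *)
  have -> : g = 0.
    apply: superspaceP => J m; rewrite [(0 : superspace C r) J]ffunE mcoeff0.
    by apply: memN_msupp_eq0; apply/negP => /hom_g[].
  rewrite superd0 subr0 => /S1; rewrite odot1l => /ffunP/(_ set0)/eqP.
  by rewrite !ffunE eqxx oner_eq0.
split=> [Idf|[g _ Ifg]]; last first.
  by have := Id _ Ifg; rewrite superdD superdN superd_superd subr0.
(* For [f = 0] the integers [a] and [b] are arbitrary and their sum may vanish, as in [(1, -1)]. A
   nonzero coefficient makes them natural numbers, with positive sum [N]. *)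
have [-> {neq0}|[J [m fJm]]] : f = 0 \/ exists J (m : 'X_{1..r}), m \in msupp (f
  J).
  have [fE|/existsNP[J fJ]] := pselect (forall J, f J = 0).
    by left; apply/ffunP => J; rewrite fE ffunE.
  right; exists J, (mlead (f J)); apply: mlead_supp.
  exact/eqP.
  exists 0; last by rewrite superd0 subr0; exact: ideal0.
  by move=> J m; rewrite ffunE msupp0.
pose N := (mdeg m + #|J|)%N; have [am bJ] := hom_f _ _ fJm.
have N0 : N%:R != 0 :> C.
  rewrite pnatr_eq0 addn_eq0; apply/negP => /andP[/eqP m0 /eqP J0]; apply: neq0.
  by rewrite -am -bJ m0 J0.
exists (ext_scale (N%:R^-1)%:MP (koszul f)).
  move=> M m'; rewrite ext_scaleE mul_mpolyC => /msuppZ_le.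
  exact: koszul_bihomog.
(* Cartan's formula divided by [N]: the remainder is a multiple of [koszul (superd f)], which lies
   in [I] along with [superd f]. *)
suff -> : f - superd (ext_scale (N%:R^-1)%:MP (koszul f)) =
          ext_scale (N%:R^-1)%:MP (koszul (superd f)).
  by apply: idealZ => //; exact: IK.
rewrite superdZ; apply/eqP; rewrite subr_eq -ext_scaleDr; apply/eqP.
apply: superspaceP => M m'; rewrite ext_scaleE mcoeffCM addrC cartan_koszul.
have [fm'|/memN_msupp_eq0->] := boolP (m' \in msupp (f M)); last first.
  by rewrite mul0rn mulr0.
have -> : (mdeg m' + #|M| = N)%N.
  have [am' bM] := hom_f _ _ fm'.
  by rewrite /N; congr (_ + _)%N; apply/eqP; rewrite -eqz_nat ?am' ?bM ?am ?bJ.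
by rewrite -[(f M)@_m' *+ N]mulr_natr mulrCA mulVf ?mulr1.
Qed.

End InverseSystemDuality.

(** * Local rings and derivations *)

Local Open Scope classical_set_scope.

Section FractionIdentities.
Variable K : fieldType.
Implicit Types a b s t : K.

Lemma fracB a b s t : s != 0 -> t != 0 ->
  a / s - b / t = (a * t - b * s) / (s * t).
Proof. by move=> s0 t0; field; rewrite s0 t0. Qed.

Lemma fracD a b s t : s != 0 -> t != 0 ->
  a / s + b / t = (a * t + b * s) / (s * t).
Proof. by move=> s0 t0; field; rewrite s0 t0. Qed.

Lemma quotient_ruleB a b s t a' b' s' t' : s != 0 -> t != 0 ->
  ((a' * t + a * t' - (b' * s + b * s')) * (s * t) -
    (a * t - b * s) * (s' * t + s * t')) / (s * t) ^+ 2 =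
  (a' * s - a * s') / s ^+ 2 - (b' * t - b * t') / t ^+ 2.
Proof. by move=> s0 t0; field; rewrite s0 t0. Qed.

Lemma quotient_ruleM a b s t a' b' s' t' : s != 0 -> t != 0 ->
  ((a' * b + a * b') * (s * t) - (a * b) * (s' * t + s * t')) / (s * t) ^+ 2 =
  (a' * s - a * s') / s ^+ 2 * (b / t) + a / s * ((b' * t - b * t') / t ^+ 2).
Proof. by move=> s0 t0; field; rewrite s0 t0. Qed.

Lemma scaled_div a s v w : s != 0 ->
  (w * a * s - a * (v * s)) / s ^+ 2 = (w - v) * (a / s).
Proof. by move=> s0; field. Qed.

Lemma divf_divr a b s : b != 0 -> s != 0 -> (a / s) / (b / s) = a / b.
Proof. by move=> b0 s0; field; rewrite b0 s0. Qed.

End FractionIdentities.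

Section LocalRings.
Variable K : fieldType.
Implicit Types (A O P Q M xi d : set K) (X : set (set K)) (x y s : K).

Lemma subring0 A : is_subring A -> A 0.
Proof. by case=> A1 AB _; rewrite -(subrr 1); apply: AB. Qed.

Lemma subringN A x : is_subring A -> A x -> A (- x).
Proof. by move=> rA Ax; case: (rA) => _ AB _; rewrite -sub0r; apply: AB => //;
  exact: subring0. Qed.

Lemma subringD A x y : is_subring A -> A x -> A y -> A (x + y).
Proof.
by move=> rA Ax Ay; case: (rA) => _ AB _; rewrite -[y]opprK; apply: AB => //;
  exact: subringN.
Qed.

Lemma subringM A x y : is_subring A -> A x -> A y -> A (x * y).
Proof. by case=> _ _; apply. Qed.

Lemma subringX A x n : is_subring A -> A x -> A (x ^+ n).
Proof.
move=> rA Ax; elim: n => [|n IHn]; first by case: rA.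
by rewrite exprS; apply: subringM.
Qed.

Lemma smallest_subring (G : set K) : is_subring (smallest (@is_subring K) G).
Proof.
split=> [B [[]] //|x y Gx Gy B [rB GB]|x y Gx Gy B [rB GB]].
  by case: (rB) => _ BB _; apply: BB; [apply: Gx|apply: Gy].
by apply: subringM => //; [apply: Gx|apply: Gy].
Qed.

Lemma ideal_sub A P x : is_ideal A P -> P x -> A x. Proof. by case=> + _ _ _;
  apply. Qed.

Lemma prime_idealE A P : prime_ideal A P -> is_ideal A P. Proof. by case. Qed.

Lemma primeM A P s t : prime_ideal A P -> A s -> A t -> ~ P s -> ~ P t ->
  ~ P (s * t).
Proof. by case=> _ _ pP As At nPs nPt /(pP _ _ As At)[]. Qed.

Lemma prime_nz A P s : prime_ideal A P -> ~ P s -> s != 0.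
Proof. by case=> [[_ P0 _ _] _ _] nPs; apply: contra_notN nPs => /eqP ->. Qed.

Lemma sub_localize A P : is_subring A -> prime_ideal A P -> A `<=` localize A P.
Proof.
move=> [A1 _ _] [_ P1 _] x Ax; exists x, 1; split=> //.
by rewrite divr1.
Qed.

Lemma localizeV A P s : is_subring A -> A s -> ~ P s -> localize A P s^-1.
Proof. by move=> [A1 _ _] As Ps; exists 1, s; split=> //; rewrite mul1r. Qed.

Lemma localize_subring A P : is_subring A -> prime_ideal A P ->
  is_subring (localize A P).
Proof.
move=> rA pP; split=> [|_ _ [a [s [Aa As Ps ->]]] [b [t [Ab At Pt ->]]]
                       |_ _ [a [s [Aa As Ps ->]]] [b [t [Ab At Pt ->]]]].
- by apply: sub_localize => //; case: rA.
- have [s0 t0] := (prime_nz pP Ps, prime_nz pP Pt).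
  exists (a * t - b * s), (s * t); split;
    [|exact: subringM|exact: primeM pP _ _ _ _|by field; rewrite s0 t0].
  by case: (rA) => _ + _; apply; exact: subringM.
have [s0 t0] := (prime_nz pP Ps, prime_nz pP Pt).
exists (a * b), (s * t); split; [exact: subringM|exact: subringM|exact: primeM
  pP _ _ _ _|].
by field; rewrite s0 t0.
Qed.

Lemma maxideal_localize A P x : is_subring A -> prime_ideal A P ->
  maxideal (localize A P) x <-> exists a s, [/\ P a, A s, ~ P s & x = a / s].
Proof.
move=> rA pP; have iP := prime_idealE pP; split=> [[[a [s [Aa As Ps ->]]] xV]|].
  exists a, s; split=> //; apply: contrapT => Pa; case: xV => [/eqP|];
    last first.
    by apply; exists s, a; split=> //; rewrite invf_div.
  by rewrite mulf_eq0 invr_eq0 (negbTE (prime_nz pP Ps)) (negbTE (prime_nz pP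
    Pa)).
case=> a [s [Pa As Ps ->]]; have Aa := ideal_sub iP Pa.
split; first by exists a, s.
have [->|a0] := eqVneq a 0; [by left; rewrite mul0r|right].
case=> b [t [Ab At Pt]]; rewrite invf_div => eq_sa;
  apply: (primeM pP As At Ps Pt).
suff -> : s * t = b * a by case: iP => _ _ _; apply.
by apply/eqP; rewrite -eqr_div ?(prime_nz pP Pt) //; apply/eqP.
Qed.

Lemma maxideal_localize_prime A P : is_subring A -> prime_ideal A P ->
  prime_ideal (localize A P) (maxideal (localize A P)).
Proof.
move=> rA pP; have iP := prime_idealE pP; have rL := localize_subring rA pP.
have [iP1 iP2 iP3 iP4] := iP.
split; first split.
- by move=> x [].
- by split; [exact: subring0|left].
- move=> x y /(maxideal_localize _ rA pP)[a [s [Pa As Ps ->]]].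
  move=> /(maxideal_localize _ rA pP)[b [t [Pb At Pt ->]]].
  have [s0 t0] := (prime_nz pP Ps, prime_nz pP Pt).
  apply/(maxideal_localize _ rA pP); exists (t * a + s * b), (s * t).
  split; [|exact: subringM|exact: primeM pP _ _ _ _|by field; rewrite s0 t0].
  by apply: iP3; apply: iP4.
- move=> x y [a [s [Aa As Ps ->]]] /(maxideal_localize _ rA pP)[b [t [Pb At Pt
  ->]]].
  have [s0 t0] := (prime_nz pP Ps, prime_nz pP Pt).
  apply/(maxideal_localize _ rA pP); exists (a * b), (s * t).
  split; [exact: iP4|exact: subringM|exact: primeM pP _ _ _ _|by field;
    rewrite s0 t0].
- case=> _ [/eqP|]; first by rewrite oner_eq0.
  by rewrite invr1; case: rL.
move=> x y Lx Ly [Lxy xyV]; apply: contrapT => /not_orP[nMx nMy].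
have VL z : localize A P z -> ~ maxideal (localize A P) z ->
    z != 0 /\ localize A P z^-1.
  move=> Lz nMz; split; first by apply: contra_notN nMz => /eqP ->; split;
    [exact: subring0|left].
  by apply: contrapT => nLz; apply: nMz; split=> //; right.
have [[x0 Vx] [y0 Vy]] := (VL _ Lx nMx, VL _ Ly nMy).
case: xyV => [/eqP|]; first by rewrite mulf_eq0 (negbTE x0) (negbTE y0).
by apply; rewrite invfM; exact: subringM.
Qed.

Lemma prime_restrict A O Q : is_subring A -> A `<=` O -> prime_ideal O Q ->
  prime_ideal A (Q `&` A).
Proof.
move=> rA sAO [[QO Q0 QD QM] Q1 pQ]; split; first split.
- by move=> x [].
- by split=> //; exact: subring0.
- by move=> x y [Qx Ax] [Qy Ay]; split; [exact: QD|exact: subringD].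
- by move=> a x Aa [Qx Ax]; split; [apply: QM => //;
  exact: sAO|exact: subringM].
- by case.
move=> x y Ax Ay [Qxy _].
by case: (pQ x y (sAO _ Ax) (sAO _ Ay) Qxy); [left|right].
Qed.

(** Elements of [A] outside [P] become units, hence lie outside [Q], so all denominators can be
    cleared within [A]. Generizations of a point of a model are thereby points of the same model. *)
Lemma localize_localize A P Q : is_subring A -> prime_ideal A P ->
  prime_ideal (localize A P) Q ->
  localize (localize A P) Q = localize A (Q `&` A).
Proof.
move=> rA pP pQ; have sAL := sub_localize rA pP.
have [[QL Q0 QD QM] Q1 _] := pQ.
have nQ s : A s -> ~ P s -> ~ Q s.
  move=> As Ps Qs; apply: Q1; rewrite -(mulVf (prime_nz pP Ps)).
  by apply: QM => //; exact: localizeV.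
apply/seteqP; split=> [_ [_ [_ [[a [s [Aa As Ps ->]]] [b [t [Ab At Pt ->]]] Qbt
  ->]]]|].
  have [s0 t0] := (prime_nz pP Ps, prime_nz pP Pt).
  have Qb : ~ Q b.
    by move=> Qb; apply: Qbt; rewrite mulrC; apply: QM => //; exact: localizeV.
  have b0 := prime_nz pQ Qb.
  exists (a * t), (s * b); split; [exact: subringM|exact: subringM| |by field;
    rewrite s0 t0 b0].
  case=> Qsb _; apply: (primeM pQ _ _ _ _ Qsb) => //;
    [exact: sAL|exact: sAL|exact: nQ].
move=> _ [a [s [Aa As QAs ->]]]; exists a, s; split=> //;
  [exact: sAL|exact: sAL|].
by move=> Qs; apply: QAs.
Qed.

Lemma subring_exprz_div A x y (k : int) : is_subring A ->
  A (x / y) -> A (y / x) -> A (x ^ k / y ^ k).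
Proof.
move=> rA Axy Ayx; case: k => k; first by rewrite -expr_div_n; exact: subringX.
by rewrite NegzE -!exprnN invrK mulrC -expr_div_n; exact: subringX.
Qed.

Lemma subring_associates A x y (k : int) : is_subring A ->
  (exists2 a, A a & a * x = y) -> (exists2 b, A b & b * y = x) -> y ^ k != 0 ->
  A (x ^ k / y ^ k).
Proof.
move=> rA [a Aa ax] [b Ab yx] yk0.
(* A power of 0 is nonzero only for exponent 0, so this is the one case in which [x] and [y] may
   vanish. *)
have [->|k0] := eqVneq k 0; first by rewrite !expr0z divr1; case: rA.
have y0 : y != 0 by apply: contra_neq yk0 => ->; rewrite exp0rz (negbTE k0).
have x0 : x != 0 by apply: contra_neq y0 => x0; rewrite -ax x0 mulr0.
by apply: subring_exprz_div => //; [rewrite -yx mulfK|rewrite -ax mulfK].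
Qed.

Definition fractions A : set K :=
  [set x | exists a s, [/\ A a, A s, s != 0 & x = a / s]].

Lemma sub_fractions A : is_subring A -> A `<=` fractions A.
Proof. by case=> A1 _ _ x Ax; exists x, 1; rewrite divr1 oner_neq0. Qed.

Lemma fractionsD A x y : is_subring A ->
  fractions A x -> fractions A y -> fractions A (x + y).
Proof.
move=> rA [a [s [Aa As s0 ->]]] [b [t [Ab At t0 ->]]].
exists (a * t + b * s), (s * t); rewrite mulf_neq0 ?fracD //; split=> //.
  by apply: subringD => //; exact: subringM.
exact: subringM.
Qed.

Lemma fractionsM A x y : is_subring A ->
  fractions A x -> fractions A y -> fractions A (x * y).
Proof.
move=> rA [a [s [Aa As s0 ->]]] [b [t [Ab At t0 ->]]].
exists (a * b), (s * t); rewrite mulf_neq0 ?mulf_div //.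
by split=> //; exact: subringM.
Qed.

Lemma fractionsV A x : is_subring A -> fractions A x -> fractions A x^-1.
Proof.
move=> rA [a [s [Aa As s0 ->]]]; have [->|a0] := eqVneq a 0.
  by rewrite mul0r invr0; apply: sub_fractions => //; exact: subring0.
by exists s, a; rewrite invf_div.
Qed.

Lemma fractionsX A x k : is_subring A -> fractions A x -> fractions A (x ^+ k).
Proof.
move=> rA Ax; elim: k => [|k IHk]; first by apply: sub_fractions => //;
  case: rA.
by rewrite exprS; exact: fractionsM.
Qed.

End LocalRings.

(** * Derivations and differential cores *)

Section Derivations.
Variables (K : fieldType) (E : K -> K).
Implicit Types (A O P Q M xi d : set K) (X : set (set K)) (x y s : K).

Hypothesis EB : forall x y, E (x - y) = E x - E y.
Hypothesis EM : forall x y, E (x * y) = E x * y + x * E y.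

Definition stable A := forall x, A x -> A (E x).

Lemma der0 : E 0 = 0. Proof. by have := EB 0 0; rewrite !subrr. Qed.
Lemma derN x : E (- x) = - E x. Proof. by rewrite -sub0r EB der0 sub0r. Qed.
Lemma derD x y : E (x + y) = E x + E y. Proof.
  by rewrite -{1}[y]opprK EB derN opprK. Qed.
Lemma der1 : E 1 = 0.
Proof.
have := EM 1 1; rewrite !mulr1 mul1r => E11.
by apply: (addIr (E 1)); rewrite add0r -E11.
Qed.
Lemma derV x : x != 0 -> E x^-1 = - (E x / x ^+ 2).
Proof.
move=> x0; have := EM x x^-1; rewrite mulfV // der1 => /esym/eqP.
rewrite addrC addr_eq0 => /eqP ExV; apply: (mulfI x0); rewrite ExV.
by field.
Qed.
Lemma der_div x y : y != 0 -> E (x / y) = (E x * y - x * E y) / y ^+ 2.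
Proof. by move=> y0; rewrite EM derV //; field. Qed.
Lemma der_sum (T : Type) (r : seq T) (F : T -> K) :
  E (\sum_(t <- r) F t) = \sum_(t <- r) E (F t).
Proof. by apply: (big_morph E); [exact: derD|exact: der0]. Qed.
Lemma der_mulrn x n : E (x *+ n) = E x *+ n.
Proof. by elim: n => [|n IHn]; rewrite ?der0 // !mulrS derD IHn. Qed.

Lemma localize_stable A P : is_subring A -> prime_ideal A P -> stable A ->
  stable (localize A P).
Proof.
move=> rA pP sA _ [a [s [Aa As Ps ->]]]; rewrite der_div ?(prime_nz pP Ps) //.
exists (E a * s - a * E s), (s ^+ 2); split=> //; [|exact: subringX|].
  by case: (rA) => _ AB _; apply: AB; apply: subringM => //; apply: sA.
by rewrite expr2; exact: primeM pP _ _ _ _.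
Qed.

Lemma smallest_subring_stable (G : set K) :
  (forall x, G x -> smallest (@is_subring K) G (E x)) ->
  stable (smallest (@is_subring K) G).
Proof.
move=> sG x Sx; set S := smallest _ G in sG Sx *.
have rS : is_subring S := smallest_subring _.
suff: S `<=` [set x | S x /\ S (E x)] by case/(_ x Sx).
apply: smallest_sub; last by move=> y Gy; split;
  [exact: sub_gen_smallest|exact: sG].
split=> [|y z [Sy SEy] [Sz SEz]|y z [Sy SEy] [Sz SEz]].
- by rewrite /= der1; split; [case: rS|exact: subring0].
- by rewrite /= EB; case: (rS) => _ SB _; split; apply: SB.
by rewrite /= EM; split; [|apply: (subringD rS)]; exact: (subringM rS).
Qed.

Lemma iter_derM n x y :
  iter n E (x * y) = \sum_(k < n.+1) (iter k E x * iter (n - k) E y) *+ 'C(n,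
    k).
Proof.
elim: n => [|n IHn]; first by rewrite big_ord1 /= bin0 mulr1n.
rewrite iterS IHn der_sum.
under eq_bigr do rewrite der_mulrn EM -iterS -iterS -subSn ?leq_ord // mulrnDl.
rewrite big_split /=.
have -> : \sum_(i < n.+1) iter i E x * iter (n.+1 - i) E y *+ 'C(n, i) =
          \sum_(i < n.+2) iter i E x * iter (n.+1 - i) E y *+ 'C(n, i).
  by rewrite [RHS]big_ord_recr /= bin_small // mulr0n addr0.
rewrite [X in _ + X]big_ord_recl [RHS]big_ord_recl !bin0 addrCA; congr (_ + _).
rewrite -big_split; apply: eq_bigr => k _.
by rewrite /= /bump add1n binS mulrnDr subSS addrC.
Qed.

Definition diffcore M : set K := [set x | forall n, M (iter n E x)].

(** Take the least [i] and [j] for which the i-th derivative of [x] and the j-th derivative of [y]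
    leave [M]. In the Leibniz expansion of the derivative of [x * y] of order [i + j], every term
    but one has a factor of lower order, hence lies in [M]. The exceptional term carries a binomial
    coefficient, which is a unit of [O]. *)
Lemma diffcore_prime O M : is_subring O -> stable O ->
  (forall n, O n.+1%:R^-1) -> (forall n, n.+1%:R != 0 :> K) ->
  prime_ideal O M -> prime_ideal O (diffcore M).
Proof.
move=> rO sO OV n0 pM; have [[sMO M0 MD MM] M1 _] := pM.
have itO n x : O x -> O (iter n E x) by move=> Ox; elim: n => //= n; exact: sO.
have Mmuln x n : M x -> M (x *+ n) by move=> Mx; elim: n => // n; rewrite mulrS;
  exact: MD.
have Msum n (F : 'I_n -> K) (Q : pred 'I_n) :
  (forall k, Q k -> M (F k)) -> M (\sum_(k < n | Q k) F k).
  by move=> MF; apply: big_ind.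
split; first split.
- by move=> x Cx; apply: sMO; exact: (Cx 0%N).
- by elim=> //= n IHn; rewrite (_ : iter n E 0 = 0) ?der0 //;
  elim: n {IHn} => //= n ->; exact: der0.
- move=> x y Cx Cy n; rewrite (_ : iter n E (x + y) = iter n E x + iter n E y);
  first exact: MD.
  by elim: n => //= n ->; exact: derD.
- move=> a x Oa Cx n; rewrite iter_derM; apply: Msum => k _.
  by apply: Mmuln; apply: MM; [exact: itO|exact: Cx].
- by move=> /(_ 0%N).
move=> x y Ox Oy Cxy; apply: contrapT => /not_orP[/existsNP nCx /existsNP nCy].
have minM z : (exists n, ~ M (iter n E z)) ->
    exists2 n, ~ M (iter n E z) & forall k, (k < n)%N -> M (iter k E z).
  case=> n0' nM; have exn : exists n, ~~ `[< M (iter n E z) >].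
    by exists n0'; apply/asboolPn.
  case: (ex_minnP exn) => n /asboolPn nMn minn; exists n => // k lt_kn.
  by apply: contrapT => /asboolPn /minn; rewrite leqNgt lt_kn.
have [i nMi lt_i] := minM _ nCx; have [j nMj lt_j] := minM _ nCy.
have lt_ij : (i < (i + j).+1)%N by rewrite ltnS leq_addr.
have := Cxy (i + j)%N; rewrite iter_derM (bigD1 (Ordinal lt_ij)) //= addKn.
set s := \sum_(k < _ | _) _ => Mtot.
have Ms : M s.
  apply: Msum => k neq_ki; apply: Mmuln.
  have [lt_ki|] := ltnP k i.
    by rewrite mulrC; apply: MM; [exact: itO|exact: lt_i].
  rewrite leq_eqVlt => /orP[/eqP ki|lt_ik].
    by case/eqP: neq_ki; apply: val_inj.
  apply: MM; [exact: itO|apply: lt_j].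
  by have := ltn_ord k; lia.
have : M (iter i E x * iter j E y *+ 'C(i + j, i)).
  rewrite -[X in M X](addrK s); apply: MD => //; rewrite -mulN1r;
    apply: MM => //.
  by apply: subringN => //; case: rO.
have := bin_gt0 (i + j) i; rewrite leq_addr; case: 'C(_, _) => // c _ Mc.
apply: (primeM pM (itO _ _ Ox) (itO _ _ Oy) nMi nMj).
by rewrite -[X in M X](mulKf (n0 c)) mulr_natl; apply: MM.
Qed.

End Derivations.

Section QuotientRule.
Variables (P : idomainType) (K : fieldType) (f : {rmorphism P -> K}).
Variables (d : P -> P) (D : K -> K).

Hypothesis f_nz : forall p, (f p == 0) = (p == 0).
Hypothesis fracP : forall x, exists p q, q != 0 /\ x = f p / f q.
Hypothesis dB : forall p q, d (p - q) = d p - d q.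
Hypothesis dM : forall p q, d (p * q) = d p * q + p * d q.
Hypothesis D_frac : forall p q, q != 0 ->
  D (f p / f q) = f (d p * q - p * d q) / f (q ^+ 2).

Lemma quotient_rule_derB x y : D (x - y) = D x - D y.
Proof.
have [p [q [q0 ->]]] := fracP x; have [p' [q' [q'0 ->]]] := fracP y.
rewrite fracB ?f_nz // -!rmorphM -rmorphB !D_frac ?mulf_neq0 // dB !dM.
by rewrite !(rmorphB, rmorphD, rmorphM, rmorphXn) quotient_ruleB ?f_nz.
Qed.

Lemma quotient_rule_derM x y : D (x * y) = D x * y + x * D y.
Proof.
have [p [q [q0 ->]]] := fracP x; have [p' [q' [q'0 ->]]] := fracP y.
rewrite mulf_div -!rmorphM !D_frac ?mulf_neq0 // !dM.
by rewrite !(rmorphB, rmorphD, rmorphM, rmorphXn) quotient_ruleM ?f_nz.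
Qed.

End QuotientRule.

Section CombinedDerivations.
Variable K : fieldType.
Implicit Types (E : K -> K) (x y : K).

Lemma commutatorB E E' :
  (forall x y, E (x - y) = E x - E y) -> (forall x y, E' (x - y) = E' x - E' y)
    ->
  forall x y, E (E' (x - y)) - E' (E (x - y)) =
    (E (E' x) - E' (E x)) - (E (E' y) - E' (E y)).
Proof. by move=> EB E'B x y; rewrite EB E'B EB E'B; ring. Qed.

Lemma commutatorM E E' :
  (forall x y, E (x - y) = E x - E y) -> (forall x y, E' (x - y) = E' x - E' y)
    ->
  (forall x y, E (x * y) = E x * y + x * E y) ->
  (forall x y, E' (x * y) = E' x * y + x * E' y) ->
  forall x y, E (E' (x * y)) - E' (E (x * y)) =
    (E (E' x) - E' (E x)) * y + x * (E (E' y) - E' (E y)).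
Proof.
move=> EB E'B EM E'M x y.
by rewrite EM E'M (derD EB) (derD E'B) !EM !E'M; ring.
Qed.

Lemma combinationB (I : finType) (c : I -> K) (D : I -> K -> K) :
  (forall i x y, D i (x - y) = D i x - D i y) ->
  forall x y, \sum_i c i * D i (x - y) =
    \sum_i c i * D i x - \sum_i c i * D i y.
Proof.
by move=> DB x y; rewrite -sumrB; apply: eq_bigr => i _; rewrite DB mulrBr.
Qed.

Lemma combinationM (I : finType) (c : I -> K) (D : I -> K -> K) :
  (forall i x y, D i (x * y) = D i x * y + x * D i y) ->
  forall x y, \sum_i c i * D i (x * y) =
    (\sum_i c i * D i x) * y + x * (\sum_i c i * D i y).
Proof.
move=> DM x y; rewrite mulr_suml mulr_sumr -big_split; apply: eq_bigr => i _.
by rewrite DM /=; ring.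
Qed.

End CombinedDerivations.

(** * Blow-ups *)

Section GoodModels.
Variables (K : fieldType) (E : K -> K) (k0 : set K).
Implicit Types (A O P Q M xi d : set K) (X Ch : set (set K)) (x y s : K).

Hypothesis EB : forall x y, E (x - y) = E x - E y.
Hypothesis EM : forall x y, E (x * y) = E x * y + x * E y.
Hypothesis k0V : forall n, k0 n.+1%:R^-1.
Hypothesis char0 : forall n, n.+1%:R != 0 :> K.

(** [k0] supplies the inverses of positive integers that make differential cores prime; the clause
    on fractions allows arbitrary elements of [K] to be differentiated by the quotient rule. *)
Definition good_ring A : Prop :=
  [/\ is_subring A, stable E A, k0 `<=` A &
      forall x, fractions A x].

Definition good_model X : Prop :=
  exists2 Ch : set (set K), (forall A, Ch A -> good_ring A) &
    X = [set O | exists A P, [/\ Ch A, prime_ideal A P & O = localize A P]].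

Lemma good_ring_sup A B : is_subring B -> stable E B -> A `<=` B ->
  good_ring A -> good_ring B.
Proof.
move=> rB sB sAB [_ _ k0A fracA]; split=> // [x /k0A/sAB //|x].
by have [a [s [/sAB Ba /sAB Bs s0 ->]]] := fracA x; exists a, s.
Qed.

Lemma good_localize A P : good_ring A -> prime_ideal A P ->
  good_ring (localize A P).
Proof.
move=> gA pP; have [rA sA _ _] := gA; apply: good_ring_sup gA.
- exact: localize_subring.
- exact: localize_stable.
exact: sub_localize.
Qed.

Lemma good_model_ring X O : good_model X -> X O -> good_ring O.
Proof. by case=> Ch gCh -> [A [P [/gCh gA pP ->]]]; exact: good_localize. Qed.

Lemma good_model_prime X O : good_model X -> X O -> prime_ideal O (maxideal O).
Proof.
case=> Ch gCh -> [A [P [/gCh[rA _ _ _] pP ->]]].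
exact: maxideal_localize_prime.
Qed.

Lemma good_model_localize X O Q : good_model X -> X O -> prime_ideal O Q ->
  X (localize O Q).
Proof.
case=> Ch gCh -> [A [P [ChA pP ->]]] pQ; have [rA _ _ _] := gCh _ ChA.
rewrite localize_localize //; exists A, (Q `&` A); split=> //.
by apply: prime_restrict pQ => //; exact: sub_localize.
Qed.

(** Geometrically, the vector field [E] is tangent to the closure of [xi]. *)
Definition stable_center xi : Prop :=
  forall x, maxideal xi x -> maxideal xi (E x).

Lemma closure_ideal_stable xi O : stable E O -> stable_center xi ->
  stable E (closure_ideal xi O).
Proof. by move=> sO sxi x [Ox mx]; split=> [|/mx/sxi//]; exact: sO. Qed.

Lemma good_blowup X xi : good_model X -> stable_center xi ->
  good_model (blowup X xi).
Proof.
move=> gX sxi.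
exists [set A | exists O f, [/\ X O, closure_ideal xi O f, f != 0 &
                                A = blowup_chart xi O f]] => [A|].
  case=> O [f [XO If f0 ->]]; have gO := good_model_ring gX XO.
  have [rO sO _ _] := gO; have rB := smallest_subring (O `|` [set h / f | h in
    closure_ideal xi O]).
  have sOB : O `<=` blowup_chart xi O f by move=> x Ox; apply: sub_gen_smallest;
    left.
  apply: (good_ring_sup rB _ sOB gO).
  apply: smallest_subring_stable => // x [Ox|[h Ih <-]].
    exact: (sOB _ (sO _ Ox)).
  rewrite -/(blowup_chart xi O f).
  have IB z : closure_ideal xi O z -> blowup_chart xi O f (z / f).
    by move=> Iz; apply: sub_gen_smallest; right; exists z.
  have sI := closure_ideal_stable sO sxi.
  (* The quotient rule expresses the derivative of [h / f] through [E h / f], [h / f] and [E f / f],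
     whose numerators are all in the ideal of the center. *)
  rewrite der_div // (_ : _ / _ = E h / f - (h / f) * (E f / f)); last by field.
  by case: (rB) => _ + _; apply; [|apply: (subringM rB)]; apply: IB => //;
    apply: sI.
apply/seteqP; split=> [O' [O [f [P [XO If f0 pP ->]]]]|O' [_ [P [[O [f [XO If f0
  ->]]] pP ->]]]].
  by exists (blowup_chart xi O f), P; split=> //; exists O, f.
by exists O, f, P.
Qed.

(* The differential core Q of the maximal ideal of d contains the ideal of the
   center, so the localization of d at Q still lies over the center; as d is
   the largest such ring, Q is the whole maximal ideal. *)
Lemma exceptional_generic_stable X xi d : good_model X ->
  (forall x y, xi x -> xi y -> xi (x * y)) -> stable_center xi ->
  generic_point (exceptional X xi) d -> stable_center d.
Proof.
move=> gX xiM sxi [[Bd [O [XO sOxi [sOd dom]]]] dmax].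
have gB := good_blowup gX sxi; have [rd sd k0d _] := good_model_ring gB Bd.
have [rO sO k0O _] := good_model_ring gX XO.
have pm := good_model_prime gB Bd.
set Q := diffcore E (maxideal d).
have pQ : prime_ideal d Q by apply: diffcore_prime => // n; exact: k0d.
have xiQ x : O x -> maxideal xi x -> Q x.
  move=> Ox mx n; have [] : O (iter n E x) /\ maxideal xi (iter n E x).
    by elim: n => //= n [On mn]; split; [exact: sO|exact: sxi].
  move: (iter n E x) => y Oy [xiy yV]; apply: dom; split=> //.
  by case: yV => [|nxi]; [left|right => /sOxi].
have pQO : prime_ideal O (Q `&` O) by exact: prime_restrict pQ.
(* [localize d Q] dominates [localize O] at the restriction of [Q]. The latter is still contained in
   [xi]: an element of [O] not invertible in [xi] lies in [Q] by [xiQ]. So [dmax] applies, and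
   elements of [d] outside [Q] are already units of [d]. *)
have sdm : localize d Q `<=` d.
  apply: dmax; split; first exact: good_model_localize.
  exists (localize O (Q `&` O)); split.
  - exact: good_model_localize.
  - move=> _ [a [s [Oa Os Qs ->]]]; apply: xiM; first exact: sOxi.
    apply: contrapT => nxi; apply: Qs; split=> //; apply: xiQ => //.
    by split; [exact: sOxi|right].
  split=> [_ [a [s [Oa Os Qs ->]]]|x].
    by exists a, s; split; [exact: sOd|exact: sOd|move=> ?; apply: Qs|].
  move=> /(maxideal_localize _ rO pQO)[a [s [[Qa Oa] Os Qs ->]]].
  apply/(maxideal_localize _ rd pQ); exists a, s; split=> //; first exact: sOd.
  by move=> ?; apply: Qs.
move=> x mx; have dx : d x by case: mx.
suff /(_ 1%N) : Q x by [].
apply: contrapT => nQx; case: (mx) => _ [x0|]; first by have := prime_nz pQ nQx;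
  rewrite x0 eqxx.
by apply; apply: sdm; exact: localizeV.
Qed.

End GoodModels.

(** * Rational functions *)

Section RationalDerivations.
Variables (C : numFieldType) (r : nat).
Local Notation P := {mpoly C[r]}.
Local Notation K := (ratfun C r).
Local Notation D := (@ratfun_deriv C r).
Implicit Types (i j : 'I_r) (p q : P) (x y : K).

Lemma ratfun_numden x :
  tofrac \n_(repr x) / tofrac \d_(repr x) = x :> K.
Proof.
have d0 : tofrac \d_(repr x) != 0 :> K by rewrite tofrac_eq0 denom_ratioP.
apply: (mulIf d0); rewrite mulfVK // -[in RHS](reprK x).
unlock tofrac; rewrite -[RHS]FracField.pi_mul; apply/eqP.
rewrite FracField.equivf_def /FracField.mulf !numden_Ratio ?mulf_neq0
  ?denom_ratioP ?oner_neq0 //.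
by rewrite reprK mulr1 mul1r.
Qed.

Lemma ratfun_fracP x : exists p q, q != 0 /\ x = tofrac p / tofrac q.
Proof. by exists \n_(repr x), \d_(repr x);
  rewrite denom_ratioP ratfun_numden. Qed.

(** [ratfun_deriv] is computed from a chosen representative; independence of the choice follows by
    differentiating the cross relation [n * q = p * d]. *)
Lemma ratfun_deriv_frac i p q : q != 0 ->
  D i (tofrac p / tofrac q) =
  tofrac (mderiv i p * q - p * mderiv i q) / tofrac (q ^+ 2).
Proof.
move=> q0; rewrite /ratfun_deriv.
set x := tofrac p / tofrac q; set n := \n_(repr x); set d := \d_(repr x).
have d0 : d != 0 by exact: denom_ratioP.
have eq_nd : n * q = p * d.
  apply/eqP; rewrite -tofrac_eq !tofracM -eqr_div ?tofrac_eq0 //.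
  by rewrite ratfun_numden.
apply/eqP; rewrite eqr_div ?tofrac_eq0 ?expf_neq0 // -!tofracM tofrac_eq;
  apply/eqP.
have := congr1 (mderiv i) eq_nd; rewrite !mderivM.
move: (mderiv i n) (mderiv i d) (mderiv i p) (mderiv i q) => n' d' p' q' eq_d.
have -> : (n' * d - n * d') * q ^+ 2 = d * q * (n' * q) - (n * q) * d' * q by
  ring.
have -> : n' * q = p' * d + p * d' - n * q' by rewrite -eq_d addrK.
rewrite eq_nd.
have -> : d * q * (p' * d + p * d' - n * q') - p * d * d' * q =
          d ^+ 2 * q * p' - d * (n * q) * q' by ring.
by rewrite eq_nd; ring.
Qed.

Lemma ratfun_deriv_tofrac i p : D i (tofrac p) = tofrac (mderiv i p).
Proof.
rewrite -[tofrac p]divr1 -(tofrac1 P) ratfun_deriv_frac ?oner_neq0 //.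
by rewrite expr1n tofrac1 divr1 -mpolyC1 mderivC mulr0 subr0 mulr1.
Qed.

Lemma ratfun_derivB i x y : D i (x - y) = D i x - D i y.
Proof.
apply: (quotient_rule_derB (f := @tofrac P) (d := mderiv i)).
- exact: tofrac_eq0.
- exact: ratfun_fracP.
- exact: mderivB.
- exact: mderivM.
exact: ratfun_deriv_frac.
Qed.

Lemma ratfun_derivM i x y : D i (x * y) = D i x * y + x * D i y.
Proof.
apply: (quotient_rule_derM (f := @tofrac P) (d := mderiv i)).
- exact: tofrac_eq0.
- exact: ratfun_fracP.
- exact: mderivM.
exact: ratfun_deriv_frac.
Qed.

(** The commutator of two derivations is a derivation, and this one vanishes on polynomials, hence
    on fractions. *)
Lemma ratfun_deriv_comm i j x : D i (D j x) = D j (D i x).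
Proof.
pose c z := D i (D j z) - D j (D i z).
have cB y z : c (y - z) = c y - c z.
  exact: (commutatorB (ratfun_derivB i) (ratfun_derivB j)).
have cM y z : c (y * z) = c y * z + y * c z.
  apply: (@commutatorM _ (D i) (D j)); [exact: ratfun_derivB|exact:
    ratfun_derivB| |];
    exact: ratfun_derivM.
have c0 p : c (tofrac p) = 0.
  by rewrite /c !ratfun_deriv_tofrac mderiv_comm subrr.
apply/eqP; rewrite -subr_eq0 -/(c x); have [p [q [q0 ->]]] := ratfun_fracP x.
rewrite (@der_div _ c cM (tofrac p) (tofrac q)) ?tofrac_eq0 //.
by rewrite !c0 mul0r mulr0 subrr mul0r.
Qed.

Definition euler x : K := \sum_(i < r) tofrac 'X_i * D i x.

Lemma eulerB x y : euler (x - y) = euler x - euler y.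
Proof. by apply: combinationB => i; exact: ratfun_derivB. Qed.

Lemma eulerM x y : euler (x * y) = euler x * y + x * euler y.
Proof. by apply: combinationM => i; exact: ratfun_derivM. Qed.

Lemma euler_tofrac p : euler (tofrac p) = tofrac (\sum_(i < r) 'X_i * mderiv i
  p).
Proof.
rewrite raddf_sum; apply: eq_bigr => i _.
by rewrite ratfun_deriv_tofrac -tofracM.
Qed.

Lemma euler_const (c : C) : euler (tofrac c%:MP) = 0.
Proof. by rewrite euler_tofrac big1 ?tofrac0 // => i _;
  rewrite mderivC mulr0. Qed.

Lemma euler_linform (l : 'cV[C]_r) : euler (tofrac (linform l)) = tofrac
  (linform l).
Proof.
rewrite euler_tofrac; congr tofrac; apply/mpolyP => m; rewrite euler_mderiv.
rewrite /linform (raddf_sum (mcoeff m)) /= -sumrMnl; apply: eq_bigr => i _.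
rewrite mcoeffZ mcoeffX; case: eqP => [<-|_]; last by rewrite mulr0 mul0rn.
by rewrite mdeg1.
Qed.

Lemma linformX i : linform (delta_mx i 0) = 'X_i :> P.
Proof.
rewrite /linform (bigD1 i) //= big1 => [|j /negbTE ji].
  by rewrite mxE !eqxx scale1r addr0.
by rewrite mxE ji scale0r.
Qed.

Definition constants : set K := range (fun c : C => tofrac c%:MP).

Lemma ratfun_natr k : k%:R = tofrac (k%:R%:MP) :> K.
Proof. by rewrite -(rmorph_nat (@tofrac P)) -(rmorph_nat (@mpolyC r C)). Qed.

Lemma ratfun_char0 k : k.+1%:R != 0 :> K.
Proof. by rewrite ratfun_natr tofrac_eq0 mpolyC_eq0 pnatr_eq0. Qed.

Lemma constants_natV k : constants k.+1%:R^-1.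
Proof.
exists k.+1%:R^-1 => //; apply: (mulIf (ratfun_char0 k)).
rewrite mulVf ?ratfun_char0 // ratfun_natr -tofracM -rmorphM.
by rewrite mulVf ?pnatr_eq0 // !rmorph1.
Qed.

End RationalDerivations.

(** * Charts of projective space *)

Section PointAtInfinity.
Variables (C : fieldType) (r : nat) (u : 'rV[C]_r).
Local Notation P := {mpoly C[r]}.
Local Notation K := (ratfun C r).
Implicit Types (p q : P) (x y : K) (k : bool).

(** Restriction to the line of multiples of [u]; degrees then measure the behaviour at its point at
    infinity. *)
Definition line_eval : P -> {poly C} := mmap (@polyC C) (fun i => u 0 i *: 'X).

HB.instance Definition _ := GRing.RMorphism.on line_eval.

Lemma line_eval_linform (l : 'cV[C]_r) :
  line_eval (linform l) = (u *m l) 0 0 *: 'X.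
Proof.
rewrite raddf_sum mxE scaler_suml; apply: eq_bigr => i _.
transitivity (line_eval (l i ord0 *: 'X_i)) => //.
by rewrite /line_eval mmapZ mmapX mmap1U mul_polyC scalerA mulrC.
Qed.

(* For k = false, the functions without pole at the point u at infinity which
   arise from the line through u; for k = true, those which vanish there. *)
Definition order_ge k : set K := [set x | exists p q,
  [/\ line_eval q != 0, (size (line_eval p) + k <= size (line_eval q))%N &
      x = tofrac p / tofrac q]].

Lemma size_mul_order k (a b c d : {poly C}) : b != 0 -> d != 0 ->
  (size a <= size b)%N -> (size c + k <= size d)%N ->
  (size (a * c)%R + k <= size (b * d)%R)%N.
Proof.
move=> b0 d0 ab cd; have bd0 : (0 < size (b * d)%R)%N.
  by rewrite size_poly_gt0 mulf_neq0.
have [->|a0] := eqVneq a 0; first by rewrite mul0r size_poly0; case: k {cd}.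
have [->|c0] := eqVneq c 0; first by rewrite mulr0 size_poly0; case: k {cd}.
rewrite !size_mul //; move: ab cd a0 c0 b0 d0; rewrite -!size_poly_gt0.
by move: (size a) (size b) (size c) (size d) => sa sb sc sd; case: k => /=; lia.
Qed.

Lemma line_eval_nz q : line_eval q != 0 -> tofrac q != 0 :> K.
Proof. by apply: contra_neq => /eqP; rewrite tofrac_eq0 => /eqP ->;
  rewrite raddf0. Qed.

Lemma order_geM k x y : order_ge false x -> order_ge k y -> order_ge k (x * y).
Proof.
move=> [p [q [q0 sz ->]]] [p' [q' [q'0 sz' ->]]]; rewrite addn0 in sz.
exists (p * p'), (q * q'); rewrite !rmorphM mulf_neq0 //; split=> //.
  exact: size_mul_order.
by rewrite mulf_div.
Qed.

Lemma order_geB k x y : order_ge k x -> order_ge k y -> order_ge k (x - y).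
Proof.
move=> [p [q [q0 sz ->]]] [p' [q' [q'0 sz' ->]]].
exists (p * q' - p' * q), (q * q'); rewrite rmorphB !rmorphM mulf_neq0 //.
split=> //; last first.
  by rewrite tofracB !tofracM; apply: fracB; exact: line_eval_nz.
rewrite (mulrC (line_eval p)) (mulrC (line_eval p')).
have sz1 : (size (line_eval q' * line_eval p)%R + k <=
              size (line_eval q * line_eval q')%R)%N.
  by rewrite [in X in (_ <= X)%N]mulrC; exact: size_mul_order.
have sz2 := size_mul_order q0 q'0 (leqnn _) sz'.
apply: leq_trans (leq_add (size_polyD _ _) (leqnn k)) _.
by rewrite addn_maxl size_polyN geq_max sz1 sz2.
Qed.

Lemma order_ge1 : ~ order_ge true 1.
Proof.
move=> [p [q [q0 sz /esym/eqP]]]; rewrite -[1]divr1 eqr_div ?oner_neq0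
  ?line_eval_nz //.
by rewrite mulr1 mul1r tofrac_eq => /eqP E; move: sz; rewrite E addn1 ltnn.
Qed.

Lemma order_ge_linform_div k (l l' : 'cV[C]_r) : (u *m l') 0 0 != 0 ->
  (k -> (u *m l) 0 0 = 0) ->
  order_ge k (tofrac (linform l) / tofrac (linform l')).
Proof.
move=> l'0 lk; exists (linform l), (linform l'); rewrite !line_eval_linform;
  split=> //.
  by rewrite scaler_eq0 polyX_eq0 orbF.
rewrite [X in (_ <= X)%N]size_scale // size_polyX; case: k lk => [->|_] //.
  by rewrite scale0r size_poly0.
by rewrite addn0 (leq_trans (size_scale_leq _ _)) ?size_polyX.
Qed.

Lemma order_ge_inv_linform (l : 'cV[C]_r) : (u *m l) 0 0 != 0 ->
  order_ge true (1 / tofrac (linform l)).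
Proof.
move=> l0; exists 1, (linform l); rewrite line_eval_linform rmorph1 tofrac1.
split=> //; first by rewrite scaler_eq0 polyX_eq0 orbF.
by rewrite size_poly1 size_scale // size_polyX.
Qed.

Lemma order_ge_const (c : C) : order_ge false (tofrac c%:MP).
Proof.
exists c%:MP, 1; rewrite rmorph1 oner_neq0 tofrac1 divr1 addn0; split=> //.
by rewrite /line_eval mmapC size_poly1 size_polyC leq_b1.
Qed.

End PointAtInfinity.

(** * Euler weights and generic points of strata on the charts *)

Section Charts.
Variables (C : numFieldType) (n r : nat) (ell : 'I_n -> 'cV[C]_r).
Local Notation P := {mpoly C[r]}.
Local Notation K := (ratfun C r).
Local Notation euler := (@euler C r).
Local Notation constants := (@constants C r).
Local Notation hcoord := (@hcoord C r).
Local Notation chart := (@proj_chart C r).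
Implicit Types (c : option 'I_r) (F : {set 'I_n}) (x y : K).

Local Notation EB := (@eulerB C r).
Local Notation EM := (@eulerM C r).

Lemma hcoord_neq0 c : hcoord c != 0.
Proof.
case: c => [i|] /=; last exact: oner_neq0.
rewrite tofrac_eq0; apply/eqP => /(congr1 (mcoeff U_(i))).
by rewrite mcoeffXU mcoeff0 eqxx => /eqP; rewrite oner_eq0.
Qed.

Lemma hcoord_divK c c' : (hcoord c / hcoord c') * (hcoord c' / hcoord c) = 1.
Proof. by rewrite -[hcoord c' / _]invf_div mulfV // mulf_neq0 ?invr_eq0
  ?hcoord_neq0. Qed.

Lemma euler_hcoord c : euler (hcoord c) = (isSome c)%:R * hcoord c.
Proof.
case: c => [i|] /=; first by rewrite mul1r -linformX euler_linform.
by rewrite mul0r -(rmorph1 (@tofrac P)) -mpolyC1 euler_const.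
Qed.

(** Linear forms have Euler weight 1 and the constant coordinate has weight 0, so the quotients
    generating the charts and the stratum ideals are eigenvectors; their weights are differences of
    two Booleans. *)
Lemma euler_hcoord_div c x (w : bool) : euler x = w%:R * x ->
  euler (x / hcoord c) = (w%:R - (isSome c)%:R) * (x / hcoord c).
Proof.
by move=> Ex; rewrite (der_div EM) ?hcoord_neq0 // Ex euler_hcoord scaled_div //
  hcoord_neq0.
Qed.

Lemma chart_subring c : is_subring (chart c).
Proof. exact: smallest_subring. Qed.

Lemma chart_const c : constants `<=` chart c.
Proof. by move=> x Cx; apply: sub_gen_smallest; left. Qed.

Lemma chart_hcoord c c' : chart c (hcoord c' / hcoord c).
Proof. by apply: sub_gen_smallest; right; exists c'. Qed.

Lemma chart_nat c (w w' : bool) : chart c (w%:R - w'%:R).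
Proof.
have rc := chart_subring c; have c1 : chart c 1 by case: rc.
case: (rc) => _ + _; apply; [case: w|case: w'] => //; exact: subring0.
Qed.

Lemma chart_stable c : stable euler (chart c).
Proof.
apply: (smallest_subring_stable EB EM) => x [[a _ <-]|[c' _ <-]].
  by rewrite euler_const; exact: (subring0 (chart_subring c)).
rewrite (euler_hcoord_div c (euler_hcoord c')).
by apply: (subringM (chart_subring c)); [exact: chart_nat|exact: chart_hcoord].
Qed.

Lemma chart_good c : good_ring euler constants (chart c).
Proof.
have rc := chart_subring c; have c1 : chart c 1 by case: rc.
have FrX i : fractions (chart c) (tofrac 'X_i).
  have -> : tofrac 'X_i = (hcoord (Some i) / hcoord c) / (hcoord None / hcoord
    c).
    by rewrite divf_divr ?hcoord_neq0 // divr1.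
  apply: fractionsM; [exact: rc| |apply: fractionsV; first exact: rc];
    by apply: sub_fractions; [exact: rc|exact: chart_hcoord].
have FrP p : fractions (chart c) (tofrac p).
  elim/mpolyind: p => [|a m p _ _ Fp].
    by rewrite tofrac0; apply: sub_fractions; [|exact: subring0].
  rewrite tofracD -mul_mpolyC tofracM; apply: fractionsD => //;
    apply: fractionsM => //.
    by apply: sub_fractions => //; apply: chart_const; exists a.
  rewrite mpolyXE_id rmorph_prod; apply: (big_ind (fractions (chart c))).
  - exact: sub_fractions.
  - by move=> x y; exact: fractionsM.
  by move=> i _; rewrite rmorphXn; apply: fractionsX; [exact: rc|exact: FrX].
split=> //; [exact: chart_stable|exact: chart_const|move=> x].
have [p [q [_ ->]]] := ratfun_fracP x.
by apply: (fractionsM rc (FrP p)); exact: fractionsV.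
Qed.

Lemma projspace_good : good_model euler constants (@projspace C r).
Proof.
exists (range chart) => [_ [c _ <-]|]; first exact: chart_good.
apply/seteqP; split=> [O [c [Q [pQ ->]]]|O [_ [Q [[c _ <-] pQ ->]]]].
  by exists (chart c), Q; split=> //; exists c.
by exists c, Q.
Qed.

Lemma stratum_ideal_stable F c : prime_ideal (chart c) (stratum_ideal ell F c)
  ->
  stable euler (stratum_ideal ell F c).
Proof.
move=> pI; have iI := prime_idealE pI; have [_ I0 ID IM] := iI.
set I := stratum_ideal ell F c in pI iI I0 ID IM *.
suff sub : I `<=` [set x | I x /\ I (euler x)] by move=> x /sub[].
apply: smallest_sub => [|x].
  split=> [x [Ix _]||x y [Ix IEx] [Iy IEy]|a x Aa [Ix IEx]].
  - exact: ideal_sub iI Ix.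
  - by split=> //; rewrite (der0 EB).
  - by split; rewrite ?(derD EB); exact: ID.
  split; first exact: IM.
  by rewrite /= EM; apply: ID; apply: IM => //; exact: chart_stable.
have gen y (w : bool) : euler y = w%:R * y -> I (y / hcoord c) ->
    I (y / hcoord c) /\ I (euler (y / hcoord c)).
  move=> Ey Iy; split=> //; rewrite (euler_hcoord_div c Ey).
  by apply: IM => //; exact: chart_nat.
case=> [->|[l l0 <-]].
  apply: gen (euler_hcoord None) _.
  by apply: sub_gen_smallest; left.
apply: (gen _ true); first by rewrite mul1r euler_linform.
by apply: sub_gen_smallest; right; exists l.
Qed.

Lemma stratum_ideal_scaled_coord F c (l : 'cV[C]_r) :
  stratum ell F *m l = 0 -> stratum_ideal ell F c (tofrac (linform l) / hcoord
    c).
Proof. by move=> l0; apply: sub_gen_smallest; right; exists l. Qed.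

(** Otherwise the ideal contains 1: in the affine chart as the coordinate on the summand [C], and in
    chart [i] as the quotient of the i-th coordinate by itself when that coordinate vanishes on the
    stratum. *)
Lemma prime_stratum_chart F c : prime_ideal (chart c) (stratum_ideal ell F c) ->
  exists2 i, c = Some i & exists j, (stratum ell F) j i != 0.
Proof.
case=> _ I1 _; case: c I1 => [i|] I1; last first.
  case: I1; rewrite -[X in stratum_ideal _ _ _ X]divr1.
  by apply: sub_gen_smallest; left.
exists i => //; apply: contrapT => /forallNP col0; apply: I1.
have := @stratum_ideal_scaled_coord F (Some i) (delta_mx i 0).
rewrite linformX (mulfV (hcoord_neq0 (Some i))); apply.
rewrite -colE; apply/colP => j.
by rewrite !mxE; apply/eqP/negPn/negP; exact: col0.
Qed.

(* A point of the stratum at infinity lying in both charts separates the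
   quotient of the two coordinates from the ideal. *)
Lemma stratum_ideal_coord_div F c c' :
  prime_ideal (chart c) (stratum_ideal ell F c) ->
  prime_ideal (chart c') (stratum_ideal ell F c') ->
  ~ stratum_ideal ell F c (hcoord c' / hcoord c).
Proof.
move=> /[dup] pI /prime_stratum_chart[i ci [j ji]].
move=> /prime_stratum_chart[i' ci' [j' ji']] Icc'; subst c c'.
set S := stratum ell F in ji ji'.
(* If neither row [j] nor row [j'] has both coordinates nonzero, the missing entries are 0 and the
   sum of the rows has both. *)
have [u [uS ui ui']] : exists u : 'rV[C]_r,
    [/\ forall l : 'cV[C]_r, S *m l = 0 ->
      u *m l = 0, u 0 i != 0 & u 0 i' != 0].
  have rowS k (l : 'cV[C]_r) : S *m l = 0 -> row k S *m l = 0.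
    by move=> Sl0; rewrite -row_mul Sl0 row0.
  have [ji'0|] := eqVneq (S j i') 0; last by exists (row j S); rewrite !mxE;
    split=> //; exact: rowS.
  have [j'i0|] := eqVneq (S j' i) 0; last by exists (row j' S); rewrite !mxE;
    split=> //; exact: rowS.
  exists (row j S + row j' S); rewrite !mxE ji'0 j'i0 addr0 add0r;
    split=> // l Sl0.
  by rewrite mulmxDl !rowS // addr0.
have uX k : (u *m (delta_mx k 0 : 'cV[C]_r)) 0 0 = u 0 k.
  by rewrite -colE mxE.
have hX k : hcoord (Some k) = tofrac (linform (delta_mx k 0)) by rewrite
  linformX.
have ord_chart : chart (Some i) `<=` order_ge u false.
  apply: smallest_sub => [|x [[a _ <-]|[[k|] _ <-]]].
  - split=> [|x y|x y]; [|exact: order_geB|exact: order_geM].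
    by rewrite -(rmorph1 (@tofrac P)) -mpolyC1; exact: order_ge_const.
  - exact: order_ge_const.
  - by rewrite !hX; apply: order_ge_linform_div; rewrite ?uX.
  have [p [q [q0 sz ->]]] : order_ge u true (hcoord None / hcoord (Some i)).
    by rewrite hX; apply: order_ge_inv_linform; rewrite uX.
  by exists p, q; split=> //; apply: leq_trans sz; rewrite leq_add2l.
have ord_ideal : stratum_ideal ell F (Some i) `<=` order_ge u true.
  suff sub : stratum_ideal ell F (Some i) `<=` chart (Some i) `&` order_ge u
    true.
    by move=> x /sub[].
  have [iI _ _] := pI; have [_ I0 _ _] := iI.
  have gen x : stratum_ideal ell F (Some i) x ->
    chart (Some i) x by exact: ideal_sub iI.
  apply: smallest_sub => [|x].
    split=> [x []||x y [Ax ox] [Ay oy]|a x Aa [Ax ox]] //.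
    - split; first exact: gen.
      by exists 0, 1; rewrite tofrac0 mul0r raddf0 rmorph1 size_poly0 size_poly1
        oner_neq0.
    - split; first exact: (subringD (chart_subring _)).
      rewrite -[y]opprK; apply: order_geB => //; rewrite -sub0r;
        apply: order_geB => //.
      by exists 0, 1; rewrite tofrac0 mul0r raddf0 rmorph1 size_poly0 size_poly1
        oner_neq0.
    split; first exact: (subringM (chart_subring _)).
    by apply: order_geM => //; exact: ord_chart.
  move=> Gx; split; first by apply: gen; exact: sub_gen_smallest.
  case: Gx => [->|[l l0 <-]].
    by rewrite hX; apply: order_ge_inv_linform; rewrite uX.
  rewrite hX; apply: order_ge_linform_div; rewrite ?uX // => _.
  by rewrite uS ?mxE.
apply: (@order_ge1 _ _ u).
(* 1 is the product of the two opposite coordinate quotients: one has no pole at [u], the other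
   would vanish there. *)
rewrite -(hcoord_divK (Some i) (Some i')); apply: order_geM;
  last exact: ord_ideal.
by rewrite !hX; apply: order_ge_linform_div; rewrite ?uX.
Qed.

(** An element of the chart [c'] is a polynomial in the coordinate quotients; [N] bounds its degree,
    and each factor of the coordinate ratio clears one denominator. *)
Lemma chart_rescale c c' x : chart c' x ->
  exists N, chart c (x * (hcoord c' / hcoord c) ^+ N).
Proof.
set y := hcoord c' / hcoord c; have rc := chart_subring c.
have cy : chart c y by exact: chart_hcoord.
have shift N M z : chart c (z * y ^+ N) -> chart c (z * y ^+ (N + M)).
  by move=> cz; rewrite exprD mulrA; apply: (subringM rc) => //;
    exact: (subringX _ rc).
apply: (smallest_sub (X := [set x | exists N, chart c (x * y ^+ N)])) =>
  {x} [|x].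
  split=> [|x z [N cx] [M cz]|x z [N cx] [M cz]].
  - by exists 0%N; rewrite mulr1; case: rc.
  - exists (N + M)%N; rewrite mulrBl; case: (rc) => _ + _; apply;
    first exact: shift.
    by rewrite addnC; exact: shift.
  exists (N + M)%N; rewrite exprD mulrACA; exact: (subringM rc).
case=> [[a _ <-]|[k _ <-]].
  by exists 0%N; rewrite mulr1; apply: chart_const; exists a.
exists 1%N; rewrite expr1 /y mulrA divfK ?hcoord_neq0 //; exact: chart_hcoord.
Qed.

Lemma stratum_ideal_rescale F c c' x :
  prime_ideal (chart c) (stratum_ideal ell F c) ->
  prime_ideal (chart c') (stratum_ideal ell F c') ->
  stratum_ideal ell F c' x ->
  exists N, stratum_ideal ell F c (x * (hcoord c' / hcoord c) ^+ N).
Proof.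
set I := stratum_ideal ell F c; set I' := stratum_ideal ell F c'.
move=> [iI _ _] [iI' _ _]; set y := hcoord c' / hcoord c.
have cy : chart c y by exact: chart_hcoord.
have [_ I0 ID IM] := iI; have [_ I'0 _ _] := iI'.
have shift N M z : I (z * y ^+ N) -> I (z * y ^+ (N + M)).
  by move=> Iz; rewrite exprD mulrA mulrC; apply: IM => //;
    exact: (subringX _ (chart_subring c)).
suff sub : I' `<=` [set x | chart c' x /\ exists N, I (x * y ^+ N)] by move=>
  /sub[].
apply: smallest_sub => {x} [|x Gx].
  split=> [x []||x z [cx [N Ix]] [cz [M Iz]]|a x ca [cx [N Ix]]] //.
  - by split; [exact: (ideal_sub iI' I'0)|exists 0%N; rewrite mul0r].
  - split; first exact: (subringD (chart_subring _)).
    exists (N + M)%N; rewrite mulrDl; apply: ID; first exact: shift.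
    by rewrite addnC; exact: shift.
  split; first exact: (subringM (chart_subring _)).
  have [M cM] := chart_rescale c ca; exists (M + N)%N.
  by rewrite exprD mulrACA; exact: IM.
split; first by apply: (ideal_sub iI'); exact: sub_gen_smallest.
exists 1%N; rewrite expr1 /y.
case: Gx => [->|[l l0 <-]]; rewrite mulrA divfK ?hcoord_neq0 //.
  by apply: sub_gen_smallest; left.
exact: stratum_ideal_scaled_coord.
Qed.

Lemma stratum_point_charts F c c' :
  prime_ideal (chart c) (stratum_ideal ell F c) ->
  prime_ideal (chart c') (stratum_ideal ell F c') ->
  localize (chart c) (stratum_ideal ell F c) `<=`
  localize (chart c') (stratum_ideal ell F c').
Proof.
move=> pI pI' _ [a [s [ca cs Is ->]]].
set y := hcoord c / hcoord c'; set y' := hcoord c' / hcoord c.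
have cy : chart c' y by exact: chart_hcoord.
have cy' : chart c y' by exact: chart_hcoord.
have yy' : y * y' = 1 by exact: hcoord_divK.
have y0 : y != 0 by apply: contra_eq_neq yy' => ->;
  rewrite mul0r eq_sym oner_neq0.
have [N1 ca'] := chart_rescale c' ca; have [N2 cs'] := chart_rescale c' cs.
rewrite -/y in ca' cs'.
have [rc rc'] := (chart_subring c, chart_subring c').
exists (a * y ^+ (N1 + N2)), (s * y ^+ (N1 + N2)); split.
- by rewrite exprD mulrA; apply: (subringM rc') => //; exact: (subringX _ rc').
- by rewrite addnC exprD mulrA; apply: (subringM rc') => //;
  exact: (subringX _ rc').
(* The new denominator stays outside the ideal: transported back to the chart [c], it is [s] times
   powers of [y'], and neither [s] nor [y'] lies in the prime ideal there. *)
- case/(stratum_ideal_rescale pI pI') => M; rewrite -/y' => IM.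
  have : stratum_ideal ell F c (s * y' ^+ M).
    have -> : s * y' ^+ M = y' ^+ (N1 + N2) * (s * y ^+ (N1 + N2) * y' ^+ M).
      by rewrite -[LHS]mul1r -(expr1n _ (N1 + N2)) -yy' exprMn; ring.
    by case: pI => -[_ _ _ +] _ _; apply=> //; exact: (subringX _ rc).
  apply: (primeM pI) => //; first exact: (subringX _ rc).
  elim: M {IM} => [|M IHM]; first by case: pI.
  rewrite exprS; apply: (primeM pI) => //; first exact: (subringX _ rc).
  exact: stratum_ideal_coord_div.
by rewrite -mulf_div mulfV ?expf_neq0 // mulr1.
Qed.

(** [stratum_point] is a union over all charts meeting the stratum; the ring structure becomes
    accessible once one chart is known to suffice. *)
Lemma stratum_pointE F c : prime_ideal (chart c) (stratum_ideal ell F c) ->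
  stratum_point ell F = localize (chart c) (stratum_ideal ell F c).
Proof.
move=> pI; apply/seteqP; split=> [x [c' pI']|x]; last by exists c.
exact: stratum_point_charts.
Qed.

Lemma stratum_pointM F x y :
  stratum_point ell F x -> stratum_point ell F y -> stratum_point ell F (x * y).
Proof.
move=> [c pI xI]; rewrite (stratum_pointE pI) => yI.
by apply: subringM => //; apply: localize_subring => //; exact: chart_subring.
Qed.

Lemma stratum_point_stable F : stable_center euler (stratum_point ell F).
Proof.
move=> x /[dup] -[[c pI _] _]; rewrite (stratum_pointE pI).
have rc := chart_subring c.
move=> /(maxideal_localize _ rc pI)[a [s [Ia cs Is ->]]].
have ca : chart c a by case: pI => iI _ _; exact: ideal_sub iI Ia.
apply/(maxideal_localize _ rc pI).
rewrite (der_div EM) ?(prime_nz pI Is) //.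
exists (euler a * s - a * euler s), (s ^+ 2); split=> //.
- case: (pI) => -[_ _ ID IM] _ _; apply: ID.
    by rewrite mulrC; apply: IM => //; exact: stratum_ideal_stable.
  by rewrite -mulrN mulrC; apply: IM => //; apply: (subringN rc);
    exact: chart_stable.
- exact: (subringX _ rc).
by rewrite expr2; exact: (primeM pI).
Qed.

Lemma blowup_along_good s : good_model euler constants (blowup_along ell s).
Proof.
rewrite /blowup_along.
elim: s (@projspace C r) projspace_good => //= F s IHs X gX.
by apply: IHs; apply: (good_blowup EB EM gX); exact: stratum_point_stable.
Qed.

Lemma divisor_point_stable F d : divisor_point ell F d -> stable_center euler d.
Proof.
apply: (@exceptional_generic_stable _ euler constants).
- exact: EB.
- exact: EM.
- exact: constants_natV.
- exact: ratfun_char0.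
- exact: blowup_along_good.
- exact: stratum_pointM.
exact: stratum_point_stable.
Qed.

End Charts.

(** * Rational differential forms *)

Section DifferentialForms.
Variables (r : nat) (K : fieldType) (D : 'I_r -> K -> K) (x : 'I_r -> K).
Implicit Types (i j : 'I_r) (a b f g h : K) (u v w : {ext K, r}).

Hypothesis DB : forall i a b, D i (a - b) = D i a - D i b.
Hypothesis DM : forall i a b, D i (a * b) = D i a * b + a * D i b.
Hypothesis DC : forall i j a, D i (D j a) = D j (D i a).
Hypothesis char_neq2 : 2%:R != 0 :> K.

Local Notation theta i := (wedge (@ext_gen r K i)).
Local Notation iota := (@contract r K).
Local Notation E := (fun a => \sum_(i < r) x i * D i a).

Definition ext_d w : {ext K, r} := \sum_(i < r) theta i (ext_map (D i) w).
Definition ext_k w : {ext K, r} := \sum_(i < r) ext_scale (x i) (iota i w).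
(** For the partial derivatives of rational functions this unfolds to [ratfun_d]. *)
Definition grad h : {ext K, r} := \sum_(i < r) ext_scale (D i h) (ext_gen K i).

Lemma ext_mapD i u v : ext_map (D i) (u + v) = ext_map (D i) u + ext_map (D i)
  v.
Proof. by apply/ffunP => J; rewrite !ffunE (derD (DB i)). Qed.

Lemma ext_map0 i : ext_map (D i) 0 = 0 :> {ext K, r}.
Proof. by apply/ffunP => J; rewrite !ffunE (der0 (DB i)). Qed.

Lemma ext_map_sum i (T : Type) (s : seq T) (F : T -> {ext K, r}) :
  ext_map (D i) (\sum_(t <- s) F t) = \sum_(t <- s) ext_map (D i) (F t).
Proof. by apply: (big_morph (ext_map (D i)));
  [exact: ext_mapD|exact: ext_map0]. Qed.

Lemma ext_mapZ i a u :
  ext_map (D i) (ext_scale a u) = ext_scale (D i a) u + ext_scale a (ext_map (D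
    i) u).
Proof. by apply/ffunP => J; rewrite [RHS]ffunE !ext_mapE DM. Qed.

Lemma ext_map_theta i j u : ext_map (D i) (theta j u) = theta j (ext_map (D i)
  u).
Proof.
apply/ffunP => J; rewrite ext_mapE !wedge_genE ext_mapE.
case: ifP => _; last by rewrite (der0 (DB i)).
have [->|->] := esign_pm1 K j J; first by rewrite !mul1r.
by rewrite !mulN1r (derN (DB i)).
Qed.

Lemma ext_dD u v : ext_d (u + v) = ext_d u + ext_d v.
Proof.
by rewrite -big_split; apply: eq_bigr => i _; rewrite ext_mapD wedgeDr.
Qed.

Lemma ext_d0 : ext_d 0 = 0.
Proof. by apply: big1 => i _; rewrite ext_map0 wedge0r. Qed.

Lemma ext_kD u v : ext_k (u + v) = ext_k u + ext_k v.
Proof.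
by rewrite -big_split; apply: eq_bigr => i _; rewrite contractD ext_scaleDr.
Qed.

Lemma ext_k0 : ext_k 0 = 0.
Proof. by apply: big1 => i _; rewrite contract0 ext_scale0r. Qed.

Lemma ext_kZ a u : ext_k (ext_scale a u) = ext_scale a (ext_k u).
Proof.
rewrite /ext_k ext_scale_sumr; apply: eq_bigr => i _.
by rewrite contractZ !ext_scaleA mulrC.
Qed.

Lemma wedge_one_form (c : 'I_r -> K) w :
  wedge (\sum_i ext_scale (c i) (ext_gen K i)) w = \sum_i ext_scale (c i) (theta
    i w).
Proof. by rewrite wedge_suml; apply: eq_bigr => i _; rewrite wedgeZl. Qed.

Lemma ext_dZ a u : ext_d (ext_scale a u) = wedge (grad a) u + ext_scale a (ext_d
  u).
Proof.
rewrite wedge_one_form /ext_d ext_scale_sumr -big_split; apply: eq_bigr => i _.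
by rewrite ext_mapZ wedgeDr !wedgeZr.
Qed.

(** Exchanging the two indices changes the sign. It is applied to second derivatives, giving that
    [dh] is closed, and to products of first derivatives, giving that the square of [dh] is 0. *)
Lemma symmetric_wedge0 (c : 'I_r -> 'I_r ->
  K) w : (forall i j, c i j = c j i) ->
  \sum_i \sum_j ext_scale (c i j) (theta i (theta j w)) = 0.
Proof.
move=> cC; set S := \sum_i _.
have SN : S = - S.
  rewrite {1}/S exchange_big -sumrN; apply: eq_bigr => i _ /=.
  rewrite -sumrN; apply: eq_bigr => j _.
  by rewrite wedge_gen_anti ext_scaleNr cC.
clearbody S; apply/ffunP => J; move/eqP: SN; rewrite -subr_eq0 opprK.
move=> /eqP/ffunP/(_ J)/eqP; rewrite !ffunE -mulr2n -mulr_natl mulf_eq0.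
by rewrite (negbTE char_neq2) => /eqP.
Qed.

Lemma ext_d_wedge_grad h w :
  ext_d (wedge (grad h) w) = - wedge (grad h) (ext_d w).
Proof.
have wd : wedge (grad h) (ext_d w) =
    \sum_j \sum_i ext_scale (D i h) (theta i (theta j (ext_map (D j) w))).
  rewrite wedge_one_form exchange_big; apply: eq_bigr => i _ /=.
  by rewrite /ext_d wedge_sumr ext_scale_sumr.
rewrite wedge_one_form wd -sumrN -[RHS]add0r.
rewrite -[X in X + _](@symmetric_wedge0 (fun j i => D j (D i h)) w) => [|i j];
  last exact: DC.
rewrite -big_split; apply: eq_bigr => j _ /=.
rewrite ext_map_sum wedge_sumr -sumrN -big_split; apply: eq_bigr => i _ /=.
by rewrite ext_mapZ wedgeDr !wedgeZr ext_map_theta (wedge_gen_anti i)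
  ext_scaleNr opprK.
Qed.

Lemma wedge_grad_sq h w : wedge (grad h) (wedge (grad h) w) = 0.
Proof.
rewrite -[RHS](@symmetric_wedge0 (fun i j => D i h * D j h) w) => [|i j];
  last exact: mulrC.
rewrite !wedge_one_form; apply: eq_bigr => i _.
rewrite wedge_sumr ext_scale_sumr; apply: eq_bigr => j _.
by rewrite wedgeZr ext_scaleA.
Qed.

Lemma gradV f : grad f^-1 = ext_scale (- f ^- 2) (grad f).
Proof.
rewrite /grad ext_scale_sumr; apply: eq_bigr => i _; rewrite ext_scaleA.
have [->|f0] := eqVneq f 0; first by rewrite invr0 (der0 (DB i)) mulr0.
by rewrite (derV (DM i)) // mulNr mulrC.
Qed.

(** The gradient of [f^-1] is a multiple of the gradient of [f], so the extra Leibniz term contains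
    a square. *)
Lemma ext_d_wedge_dlog f w :
  ext_d (wedge (ext_scale f^-1 (grad f)) w) =
  - wedge (ext_scale f^-1 (grad f)) (ext_d w).
Proof.
rewrite !wedgeZl ext_dZ ext_d_wedge_grad gradV wedgeZl wedge_grad_sq.
by rewrite ext_scale0r add0r ext_scaleNr.
Qed.

Lemma ext_k_one_form (c : 'I_r -> K) w :
  ext_k (wedge (\sum_i ext_scale (c i) (ext_gen K i)) w) =
  ext_scale (\sum_i x i * c i) w -
  wedge (\sum_i ext_scale (c i) (ext_gen K i)) (ext_k w).
Proof.
rewrite !wedge_one_form.
have -> : ext_k (\sum_i ext_scale (c i) (theta i w)) =
          \sum_i ext_scale (c i) (ext_k (theta i w)).
  rewrite (big_morph ext_k ext_kD ext_k0); apply: eq_bigr => i _.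
  exact: ext_kZ.
have -> : ext_scale (\sum_i x i * c i) w = \sum_i ext_scale (x i * c i) w.
  apply: (big_morph (fun a => ext_scale a w)); last exact: ext_scale0l.
  by move=> a b; rewrite ext_scaleDl.
rewrite -sumrB; apply: eq_bigr => i _.
rewrite mulrC -ext_scaleA -ext_scaleNr -ext_scaleDr; congr ext_scale.
rewrite /ext_k wedge_sumr (bigD1 i) //= [in RHS](bigD1 i) //= opprD addrA.
congr (_ + _).
  by rewrite contract_wedge_gen eqxx ext_scaleDr ext_scaleNr wedgeZr.
rewrite -sumrN; apply: eq_bigr => j ji.
by rewrite contract_wedge_gen eq_sym (negbTE ji) sub0r ext_scaleNr wedgeZr.
Qed.

Lemma ext_k_wedge_grad h w :
  ext_k (wedge (grad h) w) = ext_scale (E h) w - wedge (grad h) (ext_k w).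
Proof. exact: ext_k_one_form. Qed.

Lemma ext_k_wedge_dlog f w :
  ext_k (wedge (ext_scale f^-1 (grad f)) w) =
  ext_scale (f^-1 * E f) w - wedge (ext_scale f^-1 (grad f)) (ext_k w).
Proof.
by rewrite !wedgeZl ext_kZ ext_k_wedge_grad ext_scaleDr ext_scaleNr ext_scaleA.
Qed.

Lemma ext_d1 : ext_d (ext1 r K) = 0.
Proof.
apply: big1 => i _; rewrite (_ : ext_map _ _ = 0) ?wedge0r //.
apply/ffunP => J; rewrite !ffunE; case: (_ == _); rewrite ?(der0 (DB i)) //.
exact: (der1 (DM i)).
Qed.

Lemma ext_k1 : ext_k (ext1 r K) = 0.
Proof.
apply: big1 => i _; apply/ffunP => J.
rewrite ext_scaleE contractE [RHS]ffunE /ext1 ffunE.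
case: eqP => [/setP/(_ i)|_]; first by rewrite !inE eqxx.
by rewrite mulr0 if_same mulr0.
Qed.

Lemma gradM a b : grad (a * b) = ext_scale b (grad a) + ext_scale a (grad b).
Proof.
rewrite /grad !ext_scale_sumr -big_split; apply: eq_bigr => i _ /=.
by rewrite !ext_scaleA -ext_scaleDl DM mulrC.
Qed.

Lemma der_exprz i f (m : int) : f ^ m != 0 ->
  D i (f ^ m) = f ^ m * (m%:~R * (f^-1 * D i f)).
Proof.
have [->|f0 _] := eqVneq f 0.
  rewrite exp0rz; have [->|m0] := eqVneq m 0; last by rewrite eqxx.
  by move=> _; rewrite (der1 (DM i)) mul0r mulr0.
have DX k : D i (f ^+ k) = f ^+ k * (k%:R * (f^-1 * D i f)).
  elim: k => [|k IHk]; first by rewrite (der1 (DM i)) mul0r mulr0.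
  rewrite exprS DM IHk -natr1; field; exact: f0.
case: m => k; first exact: DX.
rewrite NegzE -exprnN (derV (DM i)) ?expf_neq0 // DX.
by rewrite mulrNz; field; rewrite expf_neq0 f0.
Qed.

(** The logarithmic derivative of a product. A factor may have base 0 if its exponent is 0; it then
    contributes 0 because [0^-1 = 0]. *)
Lemma grad_prod (T : finType) (Q : pred T) (f : T -> K) (m : T -> int) :
  \prod_(t | Q t) f t ^ m t != 0 ->
  grad (\prod_(t | Q t) f t ^ m t) = ext_scale (\prod_(t | Q t) f t ^ m t)
    (\sum_(t | Q t) ext_scale (m t)%:~R (ext_scale (f t)^-1 (grad (f t)))).
Proof.
move=> prod_n0.
have {}prod_n0 t : Q t -> f t ^ m t != 0.
  move=> Qt; apply: contraNneq prod_n0 => ft0.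
  by rewrite (bigD1 t) //= ft0 mul0r.
elim/big_rec2: _ => [|t v p Qt IH].
  rewrite ext_scale0r /grad big1 // => i _.
  by rewrite (der1 (DM i)) ext_scale0l.
rewrite gradM IH ext_scaleDr addrC ext_scaleA addrC; congr (_ + _).
rewrite /grad !ext_scale_sumr; apply: eq_bigr => i _.
rewrite !ext_scaleA der_exprz ?prod_n0 //; congr ext_scale.
by ring.
Qed.

End DifferentialForms.

(** * Stalks of twisted logarithmic forms *)

Section SpannedForms.
Variables (r : nat) (K : fieldType) (D : 'I_r -> K -> K) (x : 'I_r -> K).
Variables (O : set K) (Gen : set {ext K, r}) (Sh : set K).
Implicit Types (a b f g h : K) (u v w t : {ext K, r}) (G M : set {ext K, r}).

Hypothesis DB : forall i a b, D i (a - b) = D i a - D i b.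
Hypothesis DM : forall i a b, D i (a * b) = D i a * b + a * D i b.

Local Notation dd := (ext_d D).
Local Notation kk := (ext_k x).
Local Notation gradD := (grad D).

(** Over an abstract field; for rational functions [submod], [log_span] and [twisted_span] unfold to
    [is_submodule], [log_forms] and [twisted_log_forms]. *)
Definition submod : set (set {ext K, r}) :=
  [set M | [/\ M 0, forall u v, M u -> M v -> M (u + v) &
               forall a u, O a -> M u -> M (ext_scale a u)]].

Definition log_span (j : nat) : set {ext K, r} :=
  smallest submod
    [set w | exists v : 'I_j -> {ext K, r},
       (forall i, Gen (v i)) /\
       w = \big[@wedge r K/ext1 r K]_(i < j) v i].

Definition twisted_span (j : nat) : set {ext K, r} :=
  smallest submod
    [set w | exists g v, [/\ Sh g, log_span j v & w = ext_scale g v]].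

Hypothesis rO : is_subring O.
Hypothesis Gen_closed : forall t w, Gen t -> dd (wedge t w) = - wedge t (dd w).
Hypothesis Gen_contract : forall t, Gen t ->
  exists2 c, O c & forall w, kk (wedge t w) = ext_scale c w - wedge t (kk w).
Hypothesis Gen_grad : forall a, O a -> Gen (gradD a).

Lemma smallest_submod G : submod (smallest submod G).
Proof.
split=> [M [[]] //|u v Gu Gv M [mM GM]|a u Oa Gu M [mM GM]].
  by case: (mM) => _ + _; apply; [apply: Gu|apply: Gv].
by case: (mM) => _ _; apply=> //; apply: Gu.
Qed.

Lemma submodN G u : submod G -> G u -> G (- u).
Proof.
case=> _ _ GZ Gu; have -> : - u = ext_scale (-1) u.
  by apply/ffunP => J; rewrite ext_scaleE [LHS]ffunE mulN1r.
by apply: GZ => //; apply: subringN => //; case: rO.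
Qed.

Lemma log_span_submod j : submod (log_span j).
Proof. exact: smallest_submod. Qed.

Lemma twisted_span_submod j : submod (twisted_span j).
Proof. exact: smallest_submod. Qed.

Lemma log_span0 j : log_span j 0.
Proof. by case: (log_span_submod j). Qed.

Lemma log_spanD j u v : log_span j u -> log_span j v -> log_span j (u + v).
Proof. by case: (log_span_submod j) => _ + _; apply. Qed.

Lemma log_spanZ j a u : O a -> log_span j u -> log_span j (ext_scale a u).
Proof. by case: (log_span_submod j) => _ _; apply. Qed.

Lemma log_spanN j u : log_span j u -> log_span j (- u).
Proof. by apply: submodN; exact: log_span_submod. Qed.

Lemma twisted_span0 j : twisted_span j 0.
Proof. by case: (twisted_span_submod j). Qed.

Lemma twisted_spanD j u v :
  twisted_span j u -> twisted_span j v -> twisted_span j (u + v).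
Proof. by case: (twisted_span_submod j) => _ + _; apply. Qed.

Lemma twisted_spanZ j a u :
  O a -> twisted_span j u -> twisted_span j (ext_scale a u).
Proof. by case: (twisted_span_submod j) => _ _; apply. Qed.

Lemma twisted_span_scale j g v : Sh g -> log_span j v ->
  twisted_span j (ext_scale g v).
Proof. by move=> Sg lv; apply: sub_gen_smallest; exists g, v. Qed.

Lemma log_span_prod j (v : 'I_j -> {ext K, r}) : (forall i, Gen (v i)) ->
  log_span j (\big[@wedge r K/ext1 r K]_(i < j) v i).
Proof. by move=> Gv; apply: sub_gen_smallest; exists v. Qed.

Lemma log_span_wedge j t v : Gen t -> log_span j v -> log_span j.+1 (wedge t v).
Proof.
move=> Gt; move: v; apply: smallest_sub => [|_ [v [Gv ->]]].
  split=> [|u v lu lv|a u Oa lu] /=.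
  - by rewrite wedge0r; exact: log_span0.
  - by rewrite wedgeDr; exact: log_spanD.
  by rewrite wedgeZr; exact: log_spanZ.
pose v' (i : 'I_j.+1) := if unlift ord0 i is Some i' then v i' else t.
have -> : wedge t (\big[@wedge r K/ext1 r K]_(i < j) v i) =
          \big[@wedge r K/ext1 r K]_(i < j.+1) v' i.
  rewrite big_ord_recl /v' unlift_none; congr wedge.
  by apply: eq_bigr => i _; rewrite liftK.
by apply: log_span_prod => i; rewrite /v'; case: unlift.
Qed.

Lemma ext_d_prod j (v : 'I_j -> {ext K, r}) : (forall i, Gen (v i)) ->
  dd (\big[@wedge r K/ext1 r K]_(i < j) v i) = 0.
Proof.
elim: j v => [|j IHj] v Gv; first by rewrite big_ord0 (ext_d1 DB DM).
by rewrite big_ord_recl Gen_closed // IHj // wedge0r oppr0.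
Qed.

Lemma log_span_ext_d j v : log_span j v -> log_span j.+1 (dd v).
Proof.
(* Membership of [v] is carried along, since the Leibniz rule for [ext_scale a u] produces
   [wedge (grad a) u]. *)
suff sub : log_span j `<=` [set v | log_span j v /\ log_span j.+1 (dd v)].
  by move=> /sub[].
apply: smallest_sub => [|_ [w [Gw ->]]].
  split=> [|u w [lu ldu] [lw ldw]|a u Oa [lu ldu]] /=.
  - by rewrite (ext_d0 DB); split; exact: log_span0.
  - by rewrite (ext_dD DB); split; exact: log_spanD.
  rewrite (ext_dZ DM); split; first exact: log_spanZ.
  apply: log_spanD; last exact: log_spanZ.
  by apply: log_span_wedge => //; exact: Gen_grad.
by split; [exact: log_span_prod|rewrite /= ext_d_prod //; exact: log_span0].
Qed.

Lemma log_span_ext_k j v : log_span j.+1 v -> log_span j (kk v).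
Proof.
move: v; apply: smallest_sub => [|_ [w [Gw ->]]].
  split=> [|u w lu lw|a u Oa lu] /=.
  - by rewrite ext_k0; exact: log_span0.
  - by rewrite ext_kD; exact: log_spanD.
  by rewrite ext_kZ; exact: log_spanZ.
rewrite /=; elim: j w Gw => [|j IHj] w Gw.
  rewrite big_ord_recl big_ord0; have [c Oc ->] := Gen_contract (Gw ord0).
  rewrite ext_k1 wedge0r subr0; apply: log_spanZ => //.
  by have := @log_span_prod 0 (fun i => w ord0); rewrite big_ord0; apply.
rewrite big_ord_recl; have [c Oc ->] := Gen_contract (Gw ord0).
apply: log_spanD; first by apply: log_spanZ => //; apply: log_span_prod.
by apply: log_spanN; apply: log_span_wedge => //; exact: IHj.
Qed.

Lemma twisted_span_wedge j t w :
  Gen t -> twisted_span j w -> twisted_span j.+1 (wedge t w).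
Proof.
move=> Gt; move: w; apply: smallest_sub => [|_ [g [v [Sg lv ->]]]].
  split=> [|u v lu lv|a u Oa lu] /=.
  - by rewrite wedge0r; exact: twisted_span0.
  - by rewrite wedgeDr; exact: twisted_spanD.
  by rewrite wedgeZr; exact: twisted_spanZ.
by rewrite /= wedgeZr; apply: twisted_span_scale => //; exact: log_span_wedge.
Qed.

Lemma twisted_span_ext_k j w : twisted_span j.+1 w -> twisted_span j (kk w).
Proof.
move: w; apply: smallest_sub => [|_ [g [v [Sg lv ->]]]].
  split=> [|u v lu lv|a u Oa lu] /=.
  - by rewrite ext_k0; exact: twisted_span0.
  - by rewrite ext_kD; exact: twisted_spanD.
  by rewrite ext_kZ; exact: twisted_spanZ.
by rewrite /= ext_kZ; apply: twisted_span_scale => //; exact: log_span_ext_k.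
Qed.

Lemma twisted_span_ext_d j w :
  (forall g v, Sh g -> log_span j v -> twisted_span j.+1 (wedge (gradD g) v)) ->
  twisted_span j w -> twisted_span j.+1 (dd w).
Proof.
move=> Sh_grad.
suff sub : twisted_span j `<=` [set w | twisted_span j w /\ twisted_span j.+1
  (dd w)].
  by move=> /sub[].
apply: smallest_sub => [|_ [g [v [Sg lv ->]]]].
  split=> [|u v [lu ldu] [lv ldv]|a u Oa [lu ldu]] /=.
  - by rewrite (ext_d0 DB); split; exact: twisted_span0.
  - by rewrite (ext_dD DB); split; exact: twisted_spanD.
  rewrite (ext_dZ DM); split; first exact: twisted_spanZ.
  apply: twisted_spanD; last exact: twisted_spanZ.
  by apply: twisted_span_wedge => //; exact: Gen_grad.
split; first exact: twisted_span_scale.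
rewrite /= (ext_dZ DM); apply: twisted_spanD; first exact: Sh_grad.
by apply: twisted_span_scale => //; exact: log_span_ext_d.
Qed.

(** With no restriction on the twisting functions, the quotient rule writes the gradient of [a / s]
    as a combination of the generators [grad a] and [grad s] with coefficients in [K]. *)
Lemma twisted_span_grad_full j g v : (forall b, Sh b) -> fractions O g ->
  log_span j v -> twisted_span j.+1 (wedge (gradD g) v).
Proof.
move=> Sh_full [a [s [Oa Os _ ->]]] lv.
rewrite (gradM DM) wedgeDl !wedgeZl (gradV DB DM) wedgeZl ext_scaleA.
by apply: twisted_spanD; apply: twisted_span_scale => //;
  apply: log_span_wedge => //; exact: Gen_grad.
Qed.

(** Writing [g = p^-1 * a] with [a] in [O], the gradient is [p^-1] times the gradient of [a] minus
    [a] times the logarithmic derivative of [p]. The latter is an integral combination of the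
    logarithmic generators, so the twist does not grow. *)
Lemma twisted_span_grad_principal j (T : finType) (Q : pred T) (f : T -> K)
    (m : T -> int) (p := \prod_(i | Q i) f i ^ m i) g v :
  p != 0 -> (forall i, Q i -> Gen (ext_scale (f i)^-1 (gradD (f i)))) ->
  Sh p^-1 -> O (g * p) -> log_span j v ->
  twisted_span j.+1 (wedge (gradD g) v).
Proof.
move=> p0 Gf Sp Ogp lv; set a := g * p in Ogp.
have -> : g = p^-1 * a by rewrite /a mulrCA mulVf ?mulr1.
rewrite (gradM DM) (gradV DB DM) (grad_prod DM p0) -/p ext_scaleA.
rewrite wedgeDl !wedgeZl ext_scaleA.
have -> : a * - p ^- 2 * p = p^-1 * - a by field.
rewrite -ext_scaleA addrC; apply: twisted_spanD;
  apply: twisted_span_scale => //.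
  by apply: log_span_wedge => //; exact: Gen_grad.
apply: log_spanZ; first exact: subringN.
rewrite -big_filter wedge_suml big_filter;
  apply: (big_ind (log_span j.+1)) => [|u w|i Qi].
- exact: log_span0.
- exact: log_spanD.
rewrite wedgeZl; apply: log_spanZ; last by apply: log_span_wedge => //;
  exact: Gf.
have O1 : O 1 by case: rO.
have On k : O k%:R.
  by elim: k => [|k IHk]; [exact: subring0|rewrite -natr1; exact: subringD].
case: (m i) => k; first exact: On.
by rewrite NegzE mulrNz; apply: subringN => //; exact: On.
Qed.

End SpannedForms.

(** * Sections *)

Section SectionSpace.
Variables (C : numFieldType) (n r : nat) (ell : 'I_n -> 'cV[C]_r).
Local Notation P := {mpoly C[r]}.
Local Notation K := (ratfun C r).
Local Notation D := (@ratfun_deriv C r).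
Local Notation xk := (fun i : 'I_r => tofrac 'X_i : K).
Local Notation dd := (ext_d D).
Local Notation kk := (ext_k xk).
Implicit Types (O : set K) (F : {set 'I_n}) (m : {set 'I_n} -> int).

Local Notation DB := (@ratfun_derivB C r).
Local Notation DM := (@ratfun_derivM C r).
Local Notation DC := (@ratfun_deriv_comm C r).

Lemma ratfun_char_neq2 : 2%:R != 0 :> K.
Proof. exact: ratfun_char0. Qed.

Lemma wonderful_good O : wonderful ell O ->
  good_ring (@euler C r) (@constants C r) O.
Proof.
exact: (good_model_ring (@eulerM C r) (blowup_along_good ell _)).
Qed.

(** [euler] preserves the ideal of [D_F] because it preserves the maximal ideal at its generic
    point; as [f] generates this ideal, it divides [euler f]. *)
Lemma local_equation_euler F O f : wonderful ell O ->
  local_equation ell F O f ->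
  O (f^-1 * euler f).
Proof.
move=> /wonderful_good[rO sO _ _] [Of If].
have If1 : divisor_ideal ell F O f.
  by rewrite If; exists 1; rewrite ?mul1r //; case: rO.
have : divisor_ideal ell F O (euler f).
  case: If1 => _ df; split; first exact: sO.
  move=> d Fd; apply: (closure_ideal_stable sO (divisor_point_stable Fd)).
  exact: df.
rewrite If => -[a Oa <-]; have [->|f0] := eqVneq f 0.
  by rewrite invr0 mul0r; exact: subring0.
by rewrite mulrCA mulVf // mulr1.
Qed.

Lemma log_generators_closed O t w : log_generators ell O t ->
  dd (wedge t w) = - wedge t (dd w).
Proof.
case=> [[h _ <-]|[F [f [_ _ ->]]]].
  exact: (ext_d_wedge_grad DB DM DC ratfun_char_neq2).
exact: (ext_d_wedge_dlog DB DM DC ratfun_char_neq2).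
Qed.

Lemma log_generators_contract O t : wonderful ell O -> log_generators ell O t ->
  exists2 c, O c & forall w, kk (wedge t w) = ext_scale c w - wedge t (kk w).
Proof.
move=> wO; have [rO sO _ _] := wonderful_good wO.
case=> [[h Oh <-]|[F [f [_ Ff ->]]]].
  exists (euler h) => [|w]; first exact: sO.
  exact: (ext_k_wedge_grad D xk).
exists (f^-1 * euler f) => [|w]; first exact: local_equation_euler Ff.
exact: (ext_k_wedge_dlog D xk).
Qed.

Lemma log_generators_grad O a : O a -> log_generators ell O (grad D a).
Proof. by move=> Oa; left; exists a. Qed.

Lemma local_equation_unit F O f f' (k : int) : is_subring O ->
  local_equation ell F O f -> local_equation ell F O f' -> f ^ k != 0 ->
  O (f' ^ k / f ^ k).
Proof.
move=> rO [Of If] [Of' If'] fk0; have O1 : O 1 by case: rO.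
have [a Oa fa] : [set a * f' | a in O] f by rewrite -If' If; exists 1;
  rewrite ?mul1r.
have [b Ob f'b] : [set a * f | a in O] f' by rewrite -If If'; exists 1;
  rewrite ?mul1r.
by apply: (subring_associates rO _ _ fk0); [exists a|exists b].
Qed.

Lemma twisted_log_forms_grad m j O g v : wonderful ell O ->
  divisor_sheaf ell m O g -> log_forms ell j O v ->
  twisted_log_forms ell m j.+1 O (wedge (grad D g) v).
Proof.
move=> wO; have [rO sO k0O fracO] := wonderful_good wO.
pose eqs (f : {set 'I_n} -> K) :=
  forall F, proper_flat ell F -> local_equation ell F O (f F).
pose p (f : {set 'I_n} -> K) := \prod_(F : {set 'I_n} | proper_flat ell F) f F ^
  m F.
(* Without local equations of nonzero product, divisor_sheaf is all of K;
   treating this case spares a proof that W_L is smooth. *)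
have [[f [Ef p0]]|no_eqs] := pselect (exists f, eqs f /\ p f != 0); last first.
  move=> _ lv.
  apply: (twisted_span_grad_full DB DM (@log_generators_grad O)) lv => //.
  move=> b f Ef; rewrite (_ : \prod_(F | _) _ = 0) ?mulr0;
    first exact: subring0.
  by apply/eqP/negPn/negP => p0; apply: no_eqs; exists f.
move=> Sg lv; apply: (twisted_span_grad_principal DB DM rO (@log_generators_grad
  O) p0 _ _ _ lv).
- by move=> F Ff; right; exists F, (f F); split=> //; exact: Ef.
(* For [p^-1] to be in the divisor sheaf, every other choice of local equations has to give a
   product in [O * p]; local equations agree up to units. *)
- move=> f' Ef'; rewrite mulrC -prodf_div.
  apply: (big_ind O) => [|a b|F Ff]; [by case: rO|exact: subringM|].
  apply: (local_equation_unit rO (Ef _ Ff) (Ef' _ Ff)).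
  by apply: contra_neq p0 => fF0; rewrite /p (bigD1 F) //= fF0 mul0r.
exact: Sg.
Qed.

Lemma global_sections_ext_d m j w :
  global_sections ell m j w -> global_sections ell m j.+1 (dd w).
Proof.
move=> gw O wO; have [rO sO _ _] := wonderful_good wO.
apply: (twisted_span_ext_d DB DM (@log_generators_closed O)
          (@log_generators_grad O)) (gw O wO) => g v.
exact: twisted_log_forms_grad.
Qed.

Lemma global_sections_ext_k m j w :
  global_sections ell m j.+1 w -> global_sections ell m j (kk w).
Proof.
move=> gw O wO; have [rO sO _ _] := wonderful_good wO.
by apply: (twisted_span_ext_k rO) (gw O wO) => t;
  exact: log_generators_contract.
Qed.

Lemma global_sections0 m j : global_sections ell m j 0.
Proof. by move=> O _; exact: twisted_span0. Qed.

Lemma global_sections1 m : (forall F, proper_flat ell F -> 0 <= m F) ->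
  global_sections ell m 0 (ext1 r K).
Proof.
move=> m_ge0 O wO; have [rO _ _ _] := wonderful_good wO.
rewrite -(ext_scale1 (ext1 r K)); apply: twisted_span_scale.
  move=> f Ef; rewrite mul1r.
  apply: (big_ind O) => [|a b|F Ff]; [by case: rO|exact: subringM|].
  have [Of _] := Ef _ Ff; have := m_ge0 _ Ff; case: (m F) => // k _.
  exact: subringX.
have := @log_span_prod r K O (log_generators ell O) 0 (fun=> 0).
by rewrite big_ord0; apply; case.
Qed.

Lemma tofrac_esign i (J : {set 'I_r}) : tofrac (esign P i J) = esign K i J.
Proof.
rewrite /esign rmorph_prod; apply: eq_bigr => j _.
by case: ifP => _; rewrite ?rmorphN rmorph1.
Qed.

Lemma restricts_to_ext_d w f : restricts_to w f ->
  restricts_to (dd w) (superd f).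
Proof.
move=> wf J; rewrite !sum_ffunE rmorph_sum; apply: eq_bigr => i _ /=.
rewrite !wedge_genE; case: ifP => _; last by rewrite tofrac0.
by rewrite tofracM tofrac_esign !ffunE wf ratfun_deriv_tofrac.
Qed.

Lemma restricts_to_ext_k w f : restricts_to w f ->
  restricts_to (kk w) (koszul f).
Proof.
move=> wf J; rewrite !sum_ffunE rmorph_sum; apply: eq_bigr => i _ /=.
rewrite !ext_scaleE !contractE tofracM; congr (_ * _).
by case: ifP => _; rewrite ?tofrac0 // tofracM tofrac_esign wf.
Qed.

Lemma ext_component_superd j (f : superspace C r) :
  ext_component j.+1 (superd f) = superd (ext_component j f).
Proof.
apply/ffunP => J; rewrite ffunE !sum_ffunE.
transitivity (\sum_(i < r) if #|J| == j.+1 then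
    wedge (ext_gen P i) (ext_map (mderiv i) f) J else 0).
  by case: ifP => // _; rewrite big1.
apply: eq_bigr => i _; rewrite !wedge_genE !ext_mapE ffunE.
case: (boolP (i \in J)) => iJ; last by rewrite if_same.
rewrite (cardsD1 i J) iJ eqSS; case: ifP => // _.
by rewrite mderiv0 mulr0.
Qed.

Lemma section_space_superd k f :
  section_space ell k f -> section_space ell k (superd f).
Proof.
move=> Sf [|j].
  (* The exterior derivative has no component of form degree 0. *)
  exists 0; first exact: global_sections0.
  move=> J; rewrite !ffunE.
  case: eqP => [/eqP|_]; last by rewrite tofrac0.
  rewrite cards_eq0 => /eqP ->; rewrite sum_ffunE big1 ?tofrac0 // => i _.
  by rewrite wedge_genE inE.
have [w gw wf] := Sf j; exists (dd w); first exact: global_sections_ext_d.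
by rewrite ext_component_superd; exact: restricts_to_ext_d.
Qed.

Lemma ext_component_koszul j (f : superspace C r) :
  ext_component j (koszul f) = koszul (ext_component j.+1 f).
Proof.
apply/ffunP => J; rewrite ffunE !sum_ffunE.
transitivity (\sum_(i < r) if #|J| == j then
    ext_scale 'X_i (contract i f) J else 0).
  by case: ifP => // _; rewrite big1.
apply: eq_bigr => i _; rewrite !ext_scaleE !contractE ffunE.
case: (boolP (i \in J)) => iJ; first by rewrite mulr0 if_same.
by rewrite cardsU1 iJ eqSS; case: ifP => // _; rewrite !mulr0.
Qed.

Lemma section_space_koszul k f :
  section_space ell k f -> section_space ell k (koszul f).
Proof.
move=> Sf j; have [w gw wf] := Sf j.+1.
exists (kk w); first exact: global_sections_ext_k.
by rewrite ext_component_koszul; exact: restricts_to_ext_k.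
Qed.

Lemma section_space1 (k : int) : -1 <= k -> section_space ell k (ext1 r P).
Proof.
move=> k_ge [|j].
  exists (ext1 r K) => [|J]; last first.
    rewrite !ffunE; case: eqP => [->|_]; first by rewrite cards0 eqxx tofrac1.
    by case: ifP => _; rewrite tofrac0.
  apply: global_sections1 => F /andP[_ FT].
  have ltF : (#|F| < n)%N.
    by rewrite -[X in (_ < X)%N]card_ord -cardsT proper_card // properT.
  (* A proper flat has at most [n - 1] elements, so its multiplicity is at least [1 + k]; this is
     where [-1 <= k] enters. *)
  by rewrite /twist; lia.
exists 0; first exact: global_sections0.
move=> J; rewrite !ffunE; case: (J =P set0) => [->|_];
  first by rewrite cards0 tofrac0.
by rewrite if_same tofrac0.
Qed.

End SectionSpace.

Theorem theorem1p8 (R : realType) (n r : nat) (ell : 'I_n -> 'cV[R[i]]_r)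
    (k : int) (I : set (superspace R[i] r)) :
  essential ell ->
  -1 <= k ->
  bigraded_ideal I ->
  inverse_system I = section_space ell k ->
  forall a b : int, exact_mod I a b <-> (a, b) <> (0, 0).
Proof.
move=> _ k_ge idealI defS; apply: koszul_exact => // [g|g|]; rewrite defS.
- exact: section_space_superd.
- exact: section_space_koszul.
exact: section_space1.
Qed.
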